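(* Let $\mathcal{M}$ be an o-minimal expansion of $(\mathbb{R},<)$ and let $(X,\tau)$ be a definable manifold space in $\mathcal{M}$ (not necessarily Hausdorff). Then $(X,\tau)$ is curve-compact if and only if it is compact (in the classical sense that every open cover has a finite subcover).
   Context: ''Definable'' means definable in $\mathcal{M}$ with parameters. A definable family of sets is one of the form $\{\varphi(M,b): b\in B\}$ with $\varphi(x,y)$ a formula and $B$ definable. A definable topological space $(X,\tau)$, $X\subseteq \mathbb{R}^n$, is a topological space for which some definable family of subsets of $X$ is a basis of $\tau$. A definable manifold space (in the sense of van den Dries) is a definable topological space $(X,\tau)$ with a finite cover of $X$ by $\tau$-open definable sets $U_1,\ldots,U_k$ and, for each $i$, a definable bijection $h_i$ from $U_i$ onto a definable set $V_i\subseteq \mathbb{R}^{n_i}$ that is a homeomorphism between $U_i$ with the subspace topology from $\tau$ and $V_i$ with the Euclidean topology. A definable curve in $X$ is a definable map $\gamma:(a,b)\to X$ with $-\infty\leq a<b\leq+\infty$. It $\tau$-converges to $x\in X$ as $t\to a$ if for every $\tau$-neighborhood $A$ of $x$ there is $t_A\in(a,b)$ with $\gamma(s)\in A$ for all $s\in(a,t_A)$; analogously as $t\to b$. $(X,\tau)$ is curve-compact if every definable curve in $X$ $\tau$-converges to some point of $X$ as $t\to a$ and to some point of $X$ as $t\to b$. *)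

(* Defs.v *)
From HB Require Import structures.
From mathcomp Require Import all_boot all_order all_algebra.
From mathcomp Require Import all_classical all_reals all_analysis.
Export numFieldNormedType.Exports.

Set Implicit Arguments.
Unset Strict Implicit.
Unset Printing Implicit Defensive.

Import Order.TTheory GRing.Theory Num.Theory.

Local Open Scope classical_set_scope.
Local Open Scope ring_scope.

(* The symbols other than [=] and [<]; constants are the 0-ary functions. *)
Record language : Type := Language {
  rel_symbol : Type;
  rel_arity : rel_symbol -> nat;
  fun_symbol : Type;
  fun_arity : fun_symbol -> nat }.

Record expansion (L : language) (R : realType) : Type := Expansion {
  rel_interp : forall r : rel_symbol L, ('I_(rel_arity r) -> R) -> Prop;
  fun_interp : forall f : fun_symbol L, ('I_(fun_arity f) -> R) -> R }.

Inductive term (L : language) : Type :=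
| Var : nat -> term L
| App : forall f : fun_symbol L, ('I_(fun_arity f) -> term L) -> term L.

(* Variables are de Bruijn indices: [Exists] binds variable 0 of its body, in
   which the variable i of the context is renamed i.+1. *)
Inductive formula (L : language) : Type :=
| Eq : term L -> term L -> formula L
| Lt : term L -> term L -> formula L
| Rel : forall r : rel_symbol L, ('I_(rel_arity r) -> term L) -> formula L
| Not : formula L -> formula L
| And : formula L -> formula L -> formula L
| Exists : formula L -> formula L.

Section Semantics.
Context (L : language) (R : realType) (M : expansion L R).

Fixpoint eval (v : nat -> R) (t : term L) : R :=
  match t with
  | Var i => v i
  | App f s => fun_interp M (fun i => eval v (s i))
  end.

Definition extend (r : R) (v : nat -> R) : nat -> R :=
  fun i => if i is j.+1 then v j else r.

(* The symbol [<] always denotes the order of [R]. *)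
Fixpoint sat (v : nat -> R) (phi : formula L) : Prop :=
  match phi with
  | Eq s t => eval v s = eval v t
  | Lt s t => eval v s < eval v t
  | Rel r s => rel_interp M (fun i => eval v (s i))
  | Not p => ~ sat v p
  | And p q => sat v p /\ sat v q
  | Exists p => exists r : R, sat (extend r v) p
  end.

(* x_0, ..., x_(n-1), e_0, e_1, ... *)
Definition valuation n (x : 'rV[R]_n) (e : nat -> R) : nat -> R :=
  fun i => if insub i is Some j then x 0 j else e (i - n)%N.

(* The sequence [e] supplies the parameters; a formula only uses finitely many
   of them. *)
Definition definable n (A : set 'rV[R]_n) : Prop :=
  exists (phi : formula L) (e : nat -> R),
    A = [set x | sat (valuation x e) phi].

Definition definable_family n (F : set (set 'rV[R]_n)) : Prop :=
  exists (m : nat) (S : set 'rV[R]_(n + m)) (B : set 'rV[R]_m),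
    [/\ definable S, definable B
      & F = [set [set x | S (row_mx x b)] | b in B]].

Definition vec1 (t : R) : 'rV[R]_1 := const_mx t.

Definition oitv (a b : \bar R) : set R := [set t | (a < t%:E < b)%E].

Definition o_minimal : Prop :=
  forall A : set R, definable (vec1 @` A) ->
  exists (P : seq R) (I : seq (\bar R * \bar R)),
    A = [set` P] `|` \bigcup_(ab in [set` I]) oitv ab.1 ab.2.

End Semantics.

(* A subset of R^n with a topology on it, in general unrelated to the Euclidean
   topology that the library puts on [carrier] (coerced to a type). *)
Record top_space (R : realType) (n : nat) : Type := TopSpace {
  carrier : set 'rV[R]_n;
  is_open : set (set carrier);
  is_openT : is_open setT;
  is_openI : setI_closed is_open;
  is_open_bigU : forall (I : Type) (f : I -> set carrier),
    (forall i, is_open (f i)) -> is_open (\bigcup_i f i) }.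

(* Alias of the type [carrier X] that carries the topology [is_open X]. *)
Definition points (R : realType) (n : nat) (X : top_space R n) : Type :=
  carrier X.
Coercion points : top_space >-> Sortclass.

HB.instance Definition _ (R : realType) (n : nat) (X : top_space R n) :=
  Choice.copy (points X) (set_type (carrier X)).
HB.instance Definition _ (R : realType) (n : nat) (X : top_space R n) :=
  isOpenTopological.Build (points X)
    (@is_openT R n X) (@is_openI R n X) (@is_open_bigU R n X).

Section Spaces.
Context (L : language) (R : realType) (M : expansion L R).
Context (n : nat) (X : top_space R n).

Definition coords (x : X) : 'rV[R]_n := \val (x : carrier X).

Definition definable_top_space : Prop :=
  exists B : set (set X),
    basis B /\ definable_family M [set coords @` U | U in B].

(* A set used as a type ([U], [V]) has the library's subspace topology, here
   induced by the topology of [X] and by the Euclidean one respectively. *)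
Definition definable_chart (U : set X) : Prop :=
  exists (m : nat) (V : set 'rV[R]_m) (h : U -> V) (g : V -> U),
    [/\ definable M V,
        definable M (range (fun u : U => row_mx (coords (\val u)) (\val (h u)))),
        cancel h g /\ cancel g h,
        continuous h
      & continuous g].

Definition definable_manifold_space : Prop :=
  definable_top_space /\
  exists (k : nat) (U : 'I_k -> set X),
    \bigcup_i U i = [set: X] /\
    forall i, [/\ open (U i), definable M (coords @` U i)
                & definable_chart (U i)].

Definition definable_curve (a b : \bar R) (gamma : oitv a b -> X) : Prop :=
  definable M
    (range (fun t : oitv a b => row_mx (vec1 (\val t)) (coords (gamma t)))).

Definition cvg_left_end (a b : \bar R) (gamma : oitv a b -> X) (x : X) : Prop :=
  forall A : set X, nbhs x A ->
  exists tA : oitv a b, forall s : oitv a b, \val s < \val tA -> A (gamma s).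

Definition cvg_right_end (a b : \bar R) (gamma : oitv a b -> X) (x : X) : Prop :=
  forall A : set X, nbhs x A ->
  exists tA : oitv a b, forall s : oitv a b, \val tA < \val s -> A (gamma s).

Definition curve_compact : Prop :=
  forall (a b : \bar R) (gamma : oitv a b -> X),
    (a < b)%E -> definable_curve gamma ->
    (exists x, cvg_left_end gamma x) /\ (exists x, cvg_right_end gamma x).

End Spaces.

(* Main.v *)
From HB Require Import structures.
Require Import Defs.
From mathcomp Require Import all_boot all_order all_algebra finmap.
From mathcomp Require Import all_classical all_reals all_analysis.

(** A compact space is curve-compact because, by o-minimality, a definable curve
    is eventually inside or eventually outside each set of a definable basis: a
    cluster point of an end of the curve is a limit ([compact_curve_compact]).

    Conversely, an ultrafilter on X has to converge. Curve selection would reduce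
    this to curves, but it can fail in the absence of a group operation: in the pure
    order no definable curve of the region 0 < x < y tends to the origin. It has
    the following substitute ([curve_closed_closed]): a definable subset A of a
    power of the extended line that contains all the limits of its definable
    curves is closed. By induction on the number of coordinates, the slices of A
    on which one coordinate is fixed are closed. If c adheres to A but is not in
    A, a closed box around c misses the slice of A through c, while by
    o-minimality all the neighbouring slices on one side meet the box. These
    slices are closed, and their lexicographically least points in the box form a
    definable curve ([slice_selection]); its limit lies in A, in the box and in the
    slice through c, a contradiction.

    Given an ultrafilter, call a chart active if its domain belongs to it. The
    coordinates in the active charts of the points that lie in the domains of the
    active charts, and of no others, form a definable set, the cell. Let A be the
    set of the points y of the closure of the cell such that in some active chart
    y gives the coordinates of an actual point of X. Such a point is a limit of
    points of the cell, so every chart around it is active and y gives its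
    coordinates there too ([lies_over_transfer]). Hence A is closed under limits of
    definable curves: such a curve is lifted to X by one chart, has a limit in X by
    curve-compactness, and the chart around that limit is active
    ([adherent_points_curve_closed]). So A is closed and contains the whole closure
    of the cell, in particular the limit along the ultrafilter of the vector of
    coordinates. The point of X with these coordinates is a limit of the
    ultrafilter ([curve_compact_compact]).

    The extended line is needed because a curve with unbounded coordinates in one
    chart may converge to a point of another chart. It is not definable in the
    structure, so definability over it means definability of each of the parts on
    which a given set of coordinates is finite. *)

Set Implicit Arguments.
Unset Strict Implicit.
Unset Printing Implicit Defensive.

Import Order.TTheory GRing.Theory Num.Theory.
Local Open Scope classical_set_scope.
Local Open Scope ring_scope.

(** * Definable predicates on real variables *)

Section RealDefinability.
Context (L : language) (R : realType) (M : expansion L R).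

Fixpoint rename_term (f : nat -> nat) (t : term L) : term L :=
  match t with
  | Var i => Var L (f i)
  | App g s => App (fun i => rename_term f (s i))
  end.

Definition lift_renaming (f : nat -> nat) (i : nat) : nat :=
  if i is j.+1 then (f j).+1 else 0%N.

Fixpoint rename (f : nat -> nat) (p : formula L) : formula L :=
  match p with
  | Eq s t => Eq (rename_term f s) (rename_term f t)
  | Lt s t => Lt (rename_term f s) (rename_term f t)
  | Rel r s => Rel (fun i => rename_term f (s i))
  | Not q => Not (rename f q)
  | And q r => And (rename f q) (rename f r)
  | Exists q => Exists (rename (lift_renaming f) q)
  end.

Lemma eval_rename (f : nat -> nat) (v : nat -> R) (t : term L) :
  Defs.eval M v (rename_term f t) = Defs.eval M (v \o f) t.
Proof.
elim: t => [//|g s IH] /=; congr (fun_interp M).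
by apply: funext => i; exact: IH.
Qed.

Lemma sat_rename (f : nat -> nat) (v : nat -> R) (p : formula L) :
  sat M v (rename f p) <-> sat M (v \o f) p.
Proof.
elim: p f v => [s t|s t|r s|q IH|q IHq r IHr|q IH] f v /=.
- by rewrite !eval_rename.
- by rewrite !eval_rename.
- by under [X in rel_interp M X]eq_fun do rewrite eval_rename.
- by rewrite IH.
- by rewrite IHq IHr.
- have E x : extend x v \o lift_renaming f = extend x (v \o f).
    by apply: funext => -[|i].
  by split=> -[x]; rewrite ?IH ?E => H; exists x; rewrite ?IH ?E.
Qed.

Definition instance (T : Type) (v : nat -> T) (a : nat + T) : T :=
  match a with inl k => v k | inr r => r end.

(** A predicate on assignments of real values to variables is definable when a
    formula expresses it, each of whose variables is read as one of the given
    variables or as a constant. *)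
Definition rdef (Q : (nat -> R) -> Prop) : Prop :=
  exists (p : formula L) (a : nat -> nat + R),
    forall v, Q v <-> sat M (fun i => instance v (a i)) p.

Definition update (T : Type) (v : nat -> T) (k : nat) (r : T) : nat -> T :=
  fun i => if i == k then r else v i.

Lemma rdef_ext (P Q : (nat -> R) -> Prop) :
  (forall v, P v <-> Q v) -> rdef P -> rdef Q.
Proof. by move=> PQ [p [a H]]; exists p, a => v; rewrite -PQ. Qed.

Lemma rdef_subst (Q : (nat -> R) -> Prop) (b : nat -> nat + R) :
  rdef Q -> rdef (fun v => Q (fun i => instance v (b i))).
Proof.
move=> [p [a H]].
exists p, (fun i => match a i with inl k => b k | inr r => inr r end) => v.
rewrite H; set u := (X in sat M X); set w := (X in _ <-> sat M X _).
suff -> : u = w by [].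
by rewrite /u /w; apply: funext => i; case: (a i).
Qed.

Lemma rdef_not (Q : (nat -> R) -> Prop) : rdef Q -> rdef (fun v => ~ Q v).
Proof. by move=> [p [a H]]; exists (Not p), a => v /=; rewrite H. Qed.

Lemma rdef_and (P Q : (nat -> R) -> Prop) :
  rdef P -> rdef Q -> rdef (fun v => P v /\ Q v).
Proof.
move=> [p [a Hp]] [q [b Hq]].
(* Even variables carry the instantiation of the first formula, odd ones that
   of the second. *)
exists (And (rename double p) (rename (fun i => i.*2.+1) q)),
  (fun i => if odd i then b i./2 else a i./2) => v /=.
rewrite !sat_rename Hp Hq.
set u := (fun i => _ (a i)); set w := (fun i => _ (b i)).
set u' := _ \o double; set w' := _ \o (fun i => i.*2.+1).
have -> : u' = u.
  by apply: funext => i; rewrite /u' /u /= odd_double doubleK.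
have -> // : w' = w.
by apply: funext => i; rewrite /w' /w /= odd_double /= uphalf_double.
Qed.

Lemma rdef_or (P Q : (nat -> R) -> Prop) :
  rdef P -> rdef Q -> rdef (fun v => P v \/ Q v).
Proof.
move=> hP hQ; apply: rdef_ext (rdef_not (rdef_and (rdef_not hP) (rdef_not hQ))).
by move=> v; rewrite -not_orE notK.
Qed.

Lemma rdef_ex (Q : (nat -> R) -> Prop) (k : nat) :
  rdef Q -> rdef (fun v => exists r, Q (update v k r)).
Proof.
move=> [p [a H]].
pose f i := if a i is inl j then (if j == k then 0%N else i.+1) else i.+1.
exists (Exists (rename f p)), a => v /=.
have E r : (fun i => instance (update v k r) (a i)) =
    extend r (fun i => instance v (a i)) \o f.
  apply: funext => i; rewrite /f /update /=.
  by case E : (a i) => [j|r'] /=; last rewrite E //; case: (j == k); rewrite //= E.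
have HE r : Q (update v k r) <->
    sat M (extend r (fun i => instance v (a i))) (rename f p).
  by rewrite H E sat_rename.
by split=> -[r /HE Hr]; exists r.
Qed.

Lemma rdef_lt : rdef (fun v => v 0%N < v 1%N).
Proof. by exists (Lt (Var L 0) (Var L 1)), inl. Qed.

Lemma rdef_cst (P : Prop) : rdef (fun=> P).
Proof.
have F : rdef (fun=> False).
  apply: rdef_ext (rdef_subst (fun=> inl 0%N) rdef_lt) => v /=.
  by rewrite ltxx.
have [p|p] := pselect P; last by apply: rdef_ext F => v; split=> // /p.
by apply: rdef_ext (rdef_not F) => v; split=> // _; case.
Qed.

Lemma rdef_definable (n : nat) (A : set 'rV[R]_n) :
  definable M A -> rdef (fun v => A (\row_i v i)).
Proof.
move=> [p [e ->]].
exists p, (fun i => if (i < n)%N then inl i else inr (e (i - n)%N)) => v /=.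
rewrite /valuation; set u := (X in sat M X); set w := (X in _ <-> sat M X _).
suff -> : u = w by [].
apply: funext => i; rewrite /u /w.
by case: insubP => [j -> <-|/negPf-> //]; rewrite mxE.
Qed.

Lemma definable_rdef (n : nat) (Q : (nat -> R) -> Prop) (c : R) :
  rdef Q -> definable M [set x : 'rV[R]_n |
    Q (fun i => if insub i is Some j then x 0 j else c)].
Proof.
move=> [p [a H]].
(* A variable that stands for one of the n coordinates is sent to it; all the
   others become parameters. *)
pose f i := if a i is inl k then (if (k < n)%N then k else (n + i)%N)
            else (n + i)%N.
exists (rename f p), (fun i => if a i is inr r then r else c).
apply/seteqP; split=> x /=; rewrite H sat_rename.
all: set u := (X in sat M X _ -> _); set w := (X in _ -> sat M X _).
all: suff -> : u = w by [].
all: apply: funext => i; rewrite /u /w /valuation /f /=.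
all: case E : (a i) => [k|r] /=; last first.
all: try by rewrite insubF ?addKn ?E // ltnNge leq_addr.
all: case: ifP => kn; first by case: insubP => //; rewrite kn.
all: by rewrite !insubF ?addKn ?E // ltnNge leq_addr.
Qed.

End RealDefinability.

(** * Definable predicates on extended real variables *)

(** A context is a type T together with the functions on T, with values in the
    extended line, that count as its variables. Predicates on contexts avoid
    naming variables: a quantifier adds a component to a product. *)
Class coordinates (R : realType) (T : Type) := coord : set (T -> \bar R).

#[global] Instance coordinates_ereal (R : realType) : coordinates R (\bar R) := [set id].
#[global] Instance coordinates_fun (R : realType) (J : Type) :
  coordinates R (J -> \bar R) := range (fun j w => w j).
#[global] Instance coordinates_row (R : realType) (n : nat) : coordinates R 'rV[R]_n :=
  range (fun i (x : 'rV[R]_n) => (x 0 i)%:E).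
#[global] Instance coordinates_prod (R : realType) (T S : Type)
    (cT : coordinates R T) (cS : coordinates R S) : coordinates R (T * S) :=
  [set f \o fst | f in coord] `|` [set f \o snd | f in coord].

Section Substitutions.
Context (R : realType).

Definition is_term (T : Type) (cT : coordinates R T) (f : T -> \bar R) : Prop :=
  coord f \/ exists c, f = cst c.

Definition substitution (T S : Type) (cT : coordinates R T)
    (cS : coordinates R S) (q : T -> S) : Prop :=
  forall f, coord f -> is_term cT (f \o q).

Arguments is_term {T cT} f.
Arguments substitution {T S cT cS} q.

Context (T : Type) (cT : coordinates R T).

Lemma subst_id : substitution (@id T).
Proof. by move=> f cf; left. Qed.

Lemma subst_fst (A B : Type) (cA : coordinates R A) (cB : coordinates R B)
  (q : T -> A * B) : substitution q -> substitution (fun t => (q t).1).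
Proof. by move=> hq f cf; apply: (hq (f \o fst)); left; exists f. Qed.

Lemma subst_snd (A B : Type) (cA : coordinates R A) (cB : coordinates R B)
  (q : T -> A * B) : substitution q -> substitution (fun t => (q t).2).
Proof. by move=> hq f cf; apply: (hq (f \o snd)); right; exists f. Qed.

Lemma subst_pair (A B : Type) (cA : coordinates R A) (cB : coordinates R B)
    (q : T -> A) (r : T -> B) :
  substitution q -> substitution r -> substitution (fun t => (q t, r t)).
Proof. by move=> hq hr f [[g cg <-]|[g cg <-]]; [exact: hq|exact: hr]. Qed.

(** Stated for an application [q t j], so that a nest of projections followed by
    an application is decomposed by unification from the outside. *)
Lemma subst_app (J : Type) (q : T -> J -> \bar R) (j : J) :
  substitution q -> substitution (fun t => q t j).
Proof. by move=> hq _ ->; apply: (hq (fun w => w j)); exists j. Qed.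

Lemma subst_lam (J : Type) (q : T -> J -> \bar R) :
  (forall j, substitution (fun t => q t j)) -> substitution q.
Proof. by move=> hq _ [j _ <-]; exact: (hq j id). Qed.

Lemma subst_row (n : nat) (q : T -> 'rV[R]_n) (i : 'I_n) :
  substitution q -> substitution (fun t => (q t 0 i)%:E).
Proof. by move=> hq _ ->; apply: (hq (fun x => (x 0 i)%:E)); exists i. Qed.

Lemma subst_cst (c : \bar R) : substitution (fun _ : T => c).
Proof. by move=> _ ->; right; exists c. Qed.

Lemma subst_if (b : bool) (q r : T -> \bar R) :
  substitution q -> substitution r -> substitution (fun t => if b then q t else r t).
Proof. by case: b. Qed.

End Substitutions.

Arguments is_term {R T cT} f.
Arguments substitution {R T S cT cS} q.

(** Proves that an expression built from projections, entries and constants is a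
    term. *)
Ltac variables := solve [repeat first
  [ eapply subst_id | eapply subst_cst | eapply subst_pair | eapply subst_fst
  | eapply subst_snd | eapply subst_app | eapply subst_row | eapply subst_if ]].

Section ExtendedDefinability.
Context (L : language) (R : realType) (M : expansion L R).

(** Definability over the extended line: whichever variables are given
    constant values, possibly infinite ones, the remaining real variables satisfy a
    definable condition. *)
Definition edef (Q : (nat -> \bar R) -> Prop) : Prop :=
  forall s : nat -> option (\bar R),
    rdef M (fun v => Q (fun i => odflt (v i)%:E (s i))).

Lemma edef_not (Q : (nat -> \bar R) -> Prop) : edef Q -> edef (fun v => ~ Q v).
Proof. by move=> hQ s; apply: rdef_not (hQ s). Qed.

Lemma edef_and (P Q : (nat -> \bar R) -> Prop) :
  edef P -> edef Q -> edef (fun v => P v /\ Q v).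
Proof. by move=> hP hQ s; apply: rdef_and (hP s) (hQ s). Qed.

(** A quantifier over the extended line is a quantifier over the real line or
    one of the two infinite values. *)
Lemma edef_ex (Q : (nat -> \bar R) -> Prop) (k : nat) :
  edef Q -> edef (fun v => exists x, Q (update v k x)).
Proof.
move=> hQ s.
have h c : rdef M (fun v => Q (update (fun i => odflt (v i)%:E (s i)) k c)).
  apply: rdef_ext (hQ (update s k (Some c))) => v.
  set u := (X in Q X <-> _); set w := (X in _ <-> Q X).
  suff -> : u = w by [].
  by rewrite /u /w; apply: funext => i; rewrite /update; case: (i == k).
apply: rdef_ext (rdef_or (rdef_ex k (hQ (update s k None)))
                         (rdef_or (h +oo%E) (h -oo%E))) => v.
have E r : (fun i => odflt (update v k r i)%:E (update s k None i)) =
    update (fun i => odflt (v i)%:E (s i)) k r%:E.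
  by apply: funext => i; rewrite /update; case: (i == k).
split; first by move=> [[r]|[]]; rewrite ?E; [exists r%:E|exists +oo%E|exists -oo%E].
move=> [[r| |] H]; last 2 first.
- by right; left.
- by right; right.
- by left; exists r; rewrite E.
Qed.

Lemma edef_subst (Q : (nat -> \bar R) -> Prop) (b : nat -> nat + \bar R) :
  edef Q -> edef (fun v => Q (fun i => instance v (b i))).
Proof.
move=> hQ s.
pose s' i := match b i with inl k => s k | inr c => Some c end.
pose a i : nat + R := match b i with inl k => inl k | inr _ => inl 0%N end.
apply: rdef_ext (rdef_subst a (hQ s')) => v.
set u := (X in Q X <-> _); set w := (X in _ <-> Q X).
suff -> : u = w by [].
by apply: funext => i; rewrite /u /w /s' /a; case: (b i).
Qed.

Lemma edef_cst (P : Prop) : edef (fun=> P).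
Proof. by move=> s; exact: rdef_cst. Qed.

Lemma edef_lt : edef (fun v => (v 0%N < v 1%N)%E).
Proof.
move=> s.
pose a i : nat + R := if i is 0%N then if s 0%N is Some c then inr (fine c) else inl 0%N
  else if s 1%N is Some c then inr (fine c) else inl 1%N.
case E0 : (s 0%N) => [[r| |]|] /=; case E1 : (s 1%N) => [[r'| |]|] /=.
all: try by apply: rdef_ext (rdef_cst M True) => v; rewrite ?ltry ?ltNyr.
all: try by apply: rdef_ext (rdef_cst M False) => v; rewrite ?ltNge ?leey ?leNye.
all: apply: rdef_ext (rdef_subst a (rdef_lt M)) => v; rewrite /a E0 E1 /=.
all: by rewrite ?lte_fin.
Qed.

Lemma edef_definable (n : nat) (A : set 'rV[R]_n) : definable M A ->
  edef (fun v => exists x, A x /\ forall i : 'I_n, v i = (x 0 i)%:E).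
Proof.
move=> hA s.
have [fs|/existsNP[i si]] := pselect (forall i : 'I_n, forall c,
  s i = Some c -> c \is a fin_num).
- pose a i : nat + R := if s i is Some c then inr (fine c) else inl i.
  apply: rdef_ext (rdef_subst a (rdef_definable hA)) => v.
  have Ea (i : 'I_n) : (instance v (a i))%:E = odflt (v i)%:E (s i).
    by rewrite /a; case E : (s i) => [c|//] /=; rewrite fineK ?(fs i).
  split=> [H|[x [Ax xE]]]; first by eexists; split; [exact: H|move=> i; rewrite mxE Ea].
  suff -> : \row_i instance v (a i) = x by [].
  by apply/rowP => i; rewrite mxE; apply: EFin_inj; rewrite Ea xE.
- apply: rdef_ext (rdef_cst M False) => v; split=> // -[x [_ /(_ i)]].
  by move/existsNP: si => [c /not_implyP[-> /=]] + cE; rewrite cE.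
Qed.

(** Only finitely many variables matter to a formula, but nothing records how
    many: the terms form an infinite sequence. *)
Definition dfn (T : Type) (cT : coordinates R T) (P : T -> Prop) : Prop :=
  exists (Q : (nat -> \bar R) -> Prop) (a : nat -> T -> \bar R),
    [/\ edef Q, forall i, is_term (a i) & forall t, P t <-> Q (a ^~ t)].

Arguments dfn {T cT} P.

Section Closure.
Context (T : Type) (cT : coordinates R T).
Implicit Types P Q : T -> Prop.

Lemma dfn_ext P Q : (forall t, P t <-> Q t) -> dfn P -> dfn Q.
Proof. by move=> PQ [K [a [hK ha H]]]; exists K, a; split=> // t; rewrite -PQ. Qed.

Lemma dfn_subst (S : Type) (cS : coordinates R S) (P : S -> Prop) (q : T -> S) :
  substitution q -> dfn P -> dfn (fun t => P (q t)).
Proof.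
move=> hq [K [a [hK ha H]]]; exists K, (fun i => a i \o q); split=> // i.
by have [/hq//|[c ->]] := ha i; right; exists c.
Qed.

Lemma dfn_not P : dfn P -> dfn (fun t => ~ P t).
Proof.
by move=> [K [a [hK ha H]]]; exists (fun v => ~ K v), a; split=> [|//|t];
  [exact: edef_not|rewrite H].
Qed.

Lemma dfn_and P Q : dfn P -> dfn Q -> dfn (fun t => P t /\ Q t).
Proof.
move=> [K [a [hK ha HK]]] [N [b [hN hb HN]]].
exists (fun v => K (fun i => v i.*2) /\ N (fun i => v i.*2.+1)),
  (fun i => if odd i then b i./2 else a i./2); split.
- exact: edef_and (edef_subst (fun i => inl i.*2) hK)
                  (edef_subst (fun i => inl i.*2.+1) hN).
- by move=> i; case: ifP.
- move=> t; rewrite HK HN.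
  set u := a^~ t; set w := b^~ t.
  set u' := (X in _ <-> K X /\ _); set w' := (X in _ <-> _ /\ N X).
  have -> : u' = u.
    by apply: funext => i; rewrite /u' /u odd_double doubleK.
  have -> // : w' = w.
  by apply: funext => i; rewrite /w' /w /= odd_double /= uphalf_double.
Qed.

Lemma dfn_or P Q : dfn P -> dfn Q -> dfn (fun t => P t \/ Q t).
Proof.
move=> hP hQ; apply: dfn_ext (dfn_not (dfn_and (dfn_not hP) (dfn_not hQ))).
by move=> t; rewrite -not_orE notK.
Qed.

Lemma dfn_imp P Q : dfn P -> dfn Q -> dfn (fun t => P t -> Q t).
Proof.
move=> hP hQ; apply: dfn_ext (dfn_or (dfn_not hP) hQ) => t.
by rewrite implyE.
Qed.

Lemma dfn_cst (P : Prop) : dfn (fun _ : T => P).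
Proof.
exists (fun=> P), (fun _ => cst 0%E); split=> //; first exact: edef_cst.
by move=> i; right; exists 0%E.
Qed.

Lemma dfn_lt (f g : T -> \bar R) :
  substitution f -> substitution g -> dfn (fun t => (f t < g t)%E).
Proof.
move=> hf hg; exists (fun v => (v 0%N < v 1%N)%E), (fun i => if i is 0%N then f else g).
by split=> [|[|i]|//]; [exact: edef_lt|exact: (hf id)|exact: (hg id)].
Qed.

Lemma dfn_le (f g : T -> \bar R) :
  substitution f -> substitution g -> dfn (fun t => (f t <= g t)%E).
Proof.
move=> hf hg; apply: dfn_ext (dfn_not (dfn_lt hg hf)) => t.
by rewrite leNgt; split => /negP.
Qed.

Lemma dfn_eq (f g : T -> \bar R) :
  substitution f -> substitution g -> dfn (fun t => f t = g t).
Proof.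
move=> hf hg; apply: dfn_ext (dfn_and (dfn_le hf hg) (dfn_le hg hf)) => t.
by split=> [[fg gf]|->]; [apply/le_anti/andP|].
Qed.

Lemma dfn_ex (P : T -> \bar R -> Prop) :
  dfn (fun p : T * \bar R => P p.1 p.2) -> dfn (fun t => exists x, P t x).
Proof.
move=> [K [a [hK ha HK]]].
have /choice[b hb] : forall i, exists bg : (nat + \bar R) * (T -> \bar R),
    is_term bg.2 /\ forall t x (v : nat -> \bar R), v 0%N = x -> v i.+1 = bg.2 t ->
    a i (t, x) = instance v bg.1.
  move=> i; have [[[g cg <-]|[_ -> <-]]|[c ->]] := ha i.
  - by exists (inl i.+1, g); split=> [|t x v _ /= ->//]; left.
  - by exists (inl 0%N, cst 0%E); split=> [|t x v /= -> //]; right; exists 0%E.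
  - by exists (inr c, cst 0%E); split=> //; right; exists 0%E.
exists (fun v => exists x, K (fun i => instance (update v 0%N x) (b i).1)),
  (fun i => if i is j.+1 then (b j).2 else cst 0%E); split.
- exact: edef_ex (edef_subst (fun i => (b i).1) hK).
- by case=> [|i]; [right; exists 0%E|exact: (hb i).1].
- move=> t; have E x : a^~ (t, x) = fun i => instance (update (fun i =>
      (if i is j.+1 then (b j).2 else cst 0%E) t) 0 x) (b i).1.
    by apply: funext => i; apply: (hb i).2.
  by split=> -[x]; [move/(HK (t, x)); rewrite E; exists x|
    rewrite -E => /(HK (t, x)); exists x].
Qed.

Lemma dfn_seq (J : eqType) (s : seq J) (P : J -> T -> Prop) :
  (forall j, dfn (P j)) -> dfn (fun t => forall j, j \in s -> P j t).
Proof.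
move=> hP; elim: s => [|i s IH]; first by apply: dfn_ext (dfn_cst True).
apply: dfn_ext (dfn_and (hP i) IH) => t; split=> [[Pi Ps] j|h].
  by rewrite inE => /predU1P[->|/Ps].
by split=> [|j js]; apply: h; rewrite inE ?eqxx ?js ?orbT.
Qed.

Lemma dfn_forall (J : finType) (P : J -> T -> Prop) :
  (forall j, dfn (P j)) -> dfn (fun t => forall j, P j t).
Proof.
move=> hP; apply: dfn_ext (dfn_seq (enum J) hP) => t.
by split=> h j; [apply: h; rewrite mem_enum|move=> _].
Qed.

Lemma dfn_exists (J : finType) (P : J -> T -> Prop) :
  (forall j, dfn (P j)) -> dfn (fun t => exists j, P j t).
Proof.
move=> hP; apply: dfn_ext (dfn_not (dfn_forall (fun j => dfn_not (hP j)))) => t.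
by split=> [/existsNP[j /contrapT Pj]|[j Pj] h]; [exists j|exact: (h j)].
Qed.

End Closure.

Lemma dfn_all (T : Type) (cT : coordinates R T) (P : T -> \bar R -> Prop) :
  dfn (fun p : T * \bar R => P p.1 p.2) -> dfn (fun t => forall x, P t x).
Proof.
move=> hP; apply: dfn_ext (dfn_not (dfn_ex (P := fun t x => ~ P t x) (dfn_not hP))) => t.
by split=> [h x|h [x]]; [apply: contrapT => nP; apply: h; exists x|].
Qed.

(** Quantifiers over a finite family of variables, eliminated one by one. *)
Lemma dfn_ex_fun (T : Type) (cT : coordinates R T) (J : finType)
    (P : T -> (J -> \bar R) -> Prop) :
  dfn (fun p : T * (J -> \bar R) => P p.1 p.2) -> dfn (fun t => exists w, P t w).
Proof.
move=> hP.
have H (s : seq J) : dfn (fun p : T * (J -> \bar R) =>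
    exists w, (forall j, j \notin s -> w j = p.2 j) /\ P p.1 w).
  elim: s => [|i s IH].
    apply: dfn_ext hP => p; split=> [Pp|[w [wE Pw]]]; first by exists p.2.
    suff <- : w = p.2 by [].
    by apply: funext => j; exact: wE.
  pose q (p : T * (J -> \bar R) * \bar R) : T * (J -> \bar R) :=
    (p.1.1, fun j => if j == i then p.2 else p.1.2 j).
  have hq : substitution q.
    by apply: subst_pair; [variables|apply: subst_lam => j; variables].
  have := dfn_ex (P := fun p x => exists w, (forall j, j \notin s ->
    w j = if j == i then x else p.2 j) /\ P p.1 w) (dfn_subst hq IH).
  apply: dfn_ext => -[t v] /=; split.
    move=> [x [w [wE Pw]]]; exists w; split=> // j.
    by rewrite inE negb_or => /andP[/negPf ji js]; rewrite wE // ji.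
  move=> [w [wE Pw]]; exists (w i), w; split=> // j js.
  by case: eqP => [->//|/eqP ji]; apply: wE; rewrite inE negb_or ji.
pose q (t : T) : T * (J -> \bar R) := (t, fun=> 0%E).
have hq : substitution q.
  by apply: subst_pair; [variables|apply: subst_lam => j; variables].
apply: dfn_ext (dfn_subst hq (H (enum J))) => t; split=> [[w [_ Pw]]|[w Pw]].
  by exists w.
by exists w; split=> // j; rewrite mem_enum.
Qed.

Lemma dfn_all_fun (T : Type) (cT : coordinates R T) (J : finType)
    (P : T -> (J -> \bar R) -> Prop) :
  dfn (fun p : T * (J -> \bar R) => P p.1 p.2) -> dfn (fun t => forall w, P t w).
Proof.
move=> hP; apply: dfn_ext (dfn_not (dfn_ex_fun (P := fun t w => ~ P t w) (dfn_not hP))) => t.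
by split=> [h x|h [x]]; [apply: contrapT => nP; apply: h; exists x|].
Qed.

Lemma dfn_definable (n : nat) (A : set 'rV[R]_n) : definable M A ->
  dfn (fun w : 'I_n -> \bar R => exists x, A x /\ forall i, w i = (x 0 i)%:E).
Proof.
move=> hA.
exists (fun v => exists x, A x /\ forall i : 'I_n, v i = (x 0 i)%:E),
  (fun i w => if insub i is Some j then w j else 0%E); split.
- exact: edef_definable.
- move=> i; case: insubP => [j _ _|_]; first by left; exists j.
  by right; exists 0%E.
- by move=> w; split=> -[x [Ax xE]]; exists x; split=> // i; move: (xE i); rewrite valK.
Qed.

Lemma definable_dfn (n : nat) (P : 'rV[R]_n -> Prop) :
  dfn P -> definable M [set x | P x].
Proof.
move=> [K [a [hK ha HK]]].
have /choice[b hb] : forall i, exists b : nat + \bar R, forall x,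
    a i x = instance (fun k : nat => (if insub k is Some j then x 0 j else 0)%:E) b.
  move=> i; have [[j _ <-]|[c ->]] := ha i; last by exists (inr c).
  by exists (inl (val j)) => x /=; rewrite valK.
have := definable_rdef n 0 (edef_subst b hK (fun=> None)).
congr definable; apply/seteqP; split=> x /=; rewrite HK.
all: by congr K; apply: funext => i; rewrite hb.
Qed.

End ExtendedDefinability.

Arguments dfn {L R} M {T cT} P.

(** * Limits and curves in powers of the extended line *)

Section ExtendedOrder.
Context (R : realType).
Local Open Scope ereal_scope.
Implicit Types l u x y : \bar R.

Lemma ereal_between x y : x < y -> exists m, x < m < y.
Proof.
case: x y => [r| |] [s| |] //=.
- rewrite lte_fin => rs; exists (((r + s) / 2)%R)%:E.
  by rewrite !lte_fin !midf_lt.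
- by exists (r + 1)%:E; rewrite lte_fin ltrDl ltr01 ltry.
- by exists (s - 1)%:E; rewrite lte_fin ltrBlDr ltrDl ltr01 ltNyr.
- by exists 0; rewrite ltNyr ltry.
Qed.

(** The intervals [l, u] with l and u around y form a basis of neighbourhoods of
    y for the order topology of the extended line. *)
Definition around l y u : Prop := (l < y \/ l = -oo) /\ (y < u \/ u = +oo).

Lemma around_mem l y u : around l y u -> l <= y <= u.
Proof.
by move=> [hl hu]; apply/andP; split;
  [case: hl => [/ltW|->]|case: hu => [/ltW|->]]; rewrite ?leNye ?leey.
Qed.

Lemma around_cap l l' y u u' : around l y u -> around l' y u' ->
  around (maxe l l') y (mine u u').
Proof.
by rewrite /maxe /mine => -[? ?] [? ?]; split; case: ifP.
Qed.

Lemma around_all y : around -oo y +oo. Proof. by split; right. Qed.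

Definition tends (T : Type) (F : set_system T) (f : T -> \bar R) y : Prop :=
  forall l u, around l y u -> F [set t | l <= f t <= u].

Section Limits.
Context (T : Type) (F : set_system T) (FF : ProperFilter F).

(** The limit is the supremum of the s that f eventually exceeds. *)
Lemma tends_exists (f : T -> \bar R) :
  (forall s, F [set t | f t <= s] \/ F [set t | s < f t]) ->
  exists y, tends F f y.
Proof.
move=> dec; pose S := [set s | F [set t | s < f t]].
exists (ereal_sup S) => l u [hl hu].
have Fl : F [set t | l <= f t].
  case: hl => [/ereal_sup_gt[s Ss ls]|->]; last first.
    by apply: filterS filterT => t _ /=; rewrite leNye.
  by apply: filterS Ss => t /= st; exact: le_trans (ltW ls) (ltW st).
have Fu : F [set t | f t <= u].
  case: hu => [hu|->]; last by apply: filterS filterT => t _ /=; rewrite leey.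
  have [//|Su] := dec u.
  by have := ereal_sup_ubound (Su : S u); rewrite leNgt hu.
by apply: filterS2 Fl Fu => t /= -> ->.
Qed.

Lemma tends_le (f : T -> \bar R) y c : tends F f y ->
  F [set t | f t <= c] -> y <= c.
Proof.
move=> hy Fc; rewrite leNgt; apply/negP => /ereal_between[m /andP[cm my]].
have Fm : F [set t | m <= f t <= +oo] by apply: hy; split; [left|right].
have [t [/= tc /andP[mt _]]] := filter_ex (filterI Fc Fm).
by move: cm; rewrite ltNge (le_trans mt tc).
Qed.

Lemma tends_ge (f : T -> \bar R) y c : tends F f y ->
  F [set t | c <= f t] -> c <= y.
Proof.
move=> hy Fc; rewrite leNgt; apply/negP => /ereal_between[m /andP[ym mc]].
have Fm : F [set t | -oo <= f t <= m] by apply: hy; split; [right|left].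
have [t [/= tc /andP[_ tm]]] := filter_ex (filterI Fc Fm).
by move: mc; rewrite ltNge (le_trans tc tm).
Qed.

Lemma tends_unique (f : T -> \bar R) y z : tends F f y -> tends F f z -> y = z.
Proof.
have le w x : tends F f w -> tends F f x -> w <= x.
  move=> hw hx; rewrite leNgt; apply/negP => /ereal_between[m /andP[xm mw]].
  have : F [set t | -oo <= f t <= m] by apply: hx; split; [right|left].
  move=> Fm; suff : w <= m by rewrite leNgt mw.
  by apply: tends_le hw _; apply: filterS Fm => t /= /andP[].
by move=> hy hz; apply/le_anti; rewrite !le.
Qed.

Lemma tends_cst c : tends F (cst c) c.
Proof. by move=> l u /around_mem lu; apply: filterS filterT => t _. Qed.

End Limits.

Lemma tends_ultra (T : Type) (F : set_system T) (f : T -> \bar R) :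
  UltraFilter F -> exists y, tends F f y.
Proof.
move=> FU; apply: tends_exists => s.
have [|H] := in_ultra_setVsetC [set t | f t <= s] FU; first by left.
by right; apply: filterS H => t /= /negP; rewrite -ltNge.
Qed.

(** The filters of one-sided punctured neighbourhoods of a point. *)
Definition right_end (c : \bar R) : set_system (\bar R) := [set B |
  exists2 b, c < b & forall t : R, c < t%:E -> t%:E < b -> B t%:E].
Definition left_end (c : \bar R) : set_system (\bar R) := [set B |
  exists2 b, b < c & forall t : R, b < t%:E -> t%:E < c -> B t%:E].

Definition is_end (c : \bar R) (F : set_system (\bar R)) : Prop :=
  (c < +oo /\ F = right_end c) \/ (-oo < c /\ F = left_end c).

Lemma real_between x y : x < y -> exists t : R, x < t%:E < y.
Proof.
move=> /ereal_between[[r| |] /andP[xm my]]; first by exists r; rewrite xm.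
  by move: my; rewrite ltNge leey.
by move: xm; rewrite ltNge leNye.
Qed.

Lemma end_filter c F : is_end c F -> ProperFilter F.
Proof.
move=> [[c1 ->]|[c1 ->]]; split.
- by move=> [b cb h]; have [t /andP[ct tb]] := real_between cb; exact: (h t).
- split; first by exists +oo.
  + move=> P Q [b cb hb] [d cd hd]; exists (mine b d).
      by rewrite lt_min cb cd.
    by move=> t ct; rewrite lt_min => /andP[tb td]; split; [exact: hb|exact: hd].
  + by move=> P Q PQ [b cb hb]; exists b => // t ct tb; exact/PQ/hb.
- by move=> [b cb h]; have [t /andP[ct tb]] := real_between cb; exact: (h t).
- split; first by exists -oo.
  + move=> P Q [b cb hb] [d cd hd]; exists (maxe b d).
      by rewrite gt_max cb cd.
    by move=> t; rewrite gt_max => /andP[tb td] ct; split; [exact: hb|exact: hd].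
  + by move=> P Q PQ [b cb hb]; exists b => // t ct tb; exact/PQ/hb.
Qed.

Lemma tends_end c F : is_end c F -> tends F id c.
Proof.
move=> [[c1 ->]|[c1 ->]] l u [hl hu].
- exists u; first by case: hu => [|->].
  move=> t ct /ltW tu /=; rewrite tu andbT.
  by case: hl => [/ltW lc|->]; [exact: le_trans lc (ltW ct)|rewrite leNye].
- exists l; first by case: hl => [|->].
  move=> t /ltW lt ct /=; rewrite lt /=.
  by case: hu => [/ltW cu|->]; [exact: le_trans (ltW ct) cu|rewrite leey].
Qed.

Definition decided (T : Type) (F : set_system T) (A : set T) : Prop :=
  F A \/ F (~` A).

Lemma decidedU (T : Type) (F : set_system T) (A B : set T) : Filter F ->
  decided F A -> decided F B -> decided F (A `|` B).
Proof.
move=> FF [FA _|FA [FB|FB]].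
- by left; apply: filterS FA; exact: subsetUl.
- by left; apply: filterS FB; exact: subsetUr.
- by right; rewrite setCU; exact: filterI.
Qed.

Lemma decided_point c F (p : R) : is_end c F -> F [set x | x != p%:E].
Proof.
move=> [[c1 ->]|[c1 ->]].
- case: (ltP c p%:E) => cp.
    by exists p%:E => // t _ /lt_eqF /negbT.
  by exists +oo => // t ct _ /=; rewrite gt_eqF// (le_lt_trans cp).
- case: (ltP p%:E c) => cp.
    by exists p%:E => // t + _; rewrite lt_neqAle eq_sym => /andP[].
  by exists -oo => // t _ ct /=; rewrite lt_eqF// (lt_le_trans ct).
Qed.

Lemma decided_itv c F (a b : \bar R) : is_end c F ->
  decided F [set x | a < x < b].
Proof.
move=> [[c1 ->]|[c1 ->]].
- case: (leP a c) => ac; last first.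
    by right; exists a => // t _ ta /= /andP[]; rewrite ltNge (ltW ta).
  case: (ltP c b) => cb.
    by left; exists b => // t ct tb /=; rewrite tb (le_lt_trans ac).
  right; exists +oo => // t ct _ /= /andP[_]; rewrite ltNge.
  by rewrite (le_trans cb (ltW ct)).
- case: (leP c b) => cb; last first.
    by right; exists b => // t bt _ /= /andP[_]; rewrite ltNge (ltW bt).
  case: (ltP a c) => ac.
    by left; exists a => // t at_ tc /=; rewrite at_ (lt_le_trans tc).
  right; exists -oo => // t _ tc /= /andP[+ _]; rewrite ltNge.
  by rewrite (le_trans (ltW tc) ac).
Qed.

Lemma end_real c F : is_end c F -> F [set x | x \is a fin_num].
Proof. by move=> [[c1 ->]|[c1 ->]]; [exists +oo|exists -oo]. Qed.

End ExtendedOrder.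

Section Curves.
Context (L : language) (R : realType) (M : expansion L R) (hM : o_minimal M).

Notation dfn := (dfn M).

(** The only use of o-minimality: a definable predicate is eventually constant at
    either side of any point of the extended line. *)
Lemma end_decided c (F : set_system (\bar R)) (P : \bar R -> Prop) :
  is_end c F -> dfn P -> decided F P.
Proof.
move=> Fe hP; have FF := end_filter Fe.
have [|S [Is E]] := hM (A := [set r | P r%:E]).
  have := definable_dfn (dfn_subst (subst_row (n := 1) 0 (@subst_id _ _ _)) hP).
  congr definable; apply/seteqP; split=> [x Px|_ [r Pr <-]] /=; last by rewrite mxE.
  by exists (x 0 0) => //; apply/rowP => i; rewrite mxE ord1.
pose D := decided F.
have ext (A B : set (\bar R)) : (forall r : R, A r%:E <-> B r%:E) -> D A -> D B.
  move=> AB; have Ffin := end_real Fe.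
  case=> H; [left|right]; apply: filterS2 Ffin H => -[r| |] //= _; first by move/AB.
  by move=> + /AB.
suff H : D [set x | (exists2 p, p \in S & x = p%:E) \/
    exists2 ab, ab \in Is & (ab.1 < x < ab.2)%E].
  apply: ext H => r /=.
  have : [set r | P r%:E] r <->
      ([set` S] `|` \bigcup_(ab in [set` Is]) oitv ab.1 ab.2) r by rewrite E.
  move=> /= ->; split.
    by case=> [[p pS [->]]|[ab abI h]]; [left|right; exists ab].
  by case=> [rS|[ab abI h]]; [left; exists r|right; exists ab].
have sub (A B : set (\bar R)) : A `<=>` B -> D A -> D B by move=> /seteqP ->.
have D0 (A : set (\bar R)) : (forall x, ~ A x) -> D A.
  by move=> A0; right; apply: filterS filterT => x _; exact: A0.
apply: decidedU.
  elim: S {E} => [|p s IH]; first by apply: D0 => x [].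
  have Dp : D [set p%:E].
    by right; apply: filterS (decided_point p Fe) => x /= /eqP.
  apply: sub (decidedU _ Dp IH); split=> x /=.
    by case=> [->|[q qs ->]]; [exists p|exists q]; rewrite ?inE ?eqxx ?qs ?orbT.
  by move=> [q]; rewrite inE => /predU1P[->|qs] ->; [left|right; exists q].
elim: Is {E} => [|p s IH]; first by apply: D0 => x [].
have Dp : D [set x | (p.1 < x < p.2)%E] by exact: decided_itv Fe.
apply: sub (decidedU _ Dp IH); split=> x /=.
  by case=> [h|[q qs h]]; [exists p|exists q]; rewrite ?inE ?eqxx ?qs ?orbT.
by move=> [q]; rewrite inE => /predU1P[->|qs] h; [left|right; exists q].
Qed.

(** If P failed eventually on both sides of c, then a small interval around c
    would contain no point of P. *)
Lemma end_exists c (P : \bar R -> Prop) : dfn P -> ~ P c ->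
  (forall l u, around l c u -> exists2 t, P t & (l <= t <= u)%E) ->
  exists2 F, is_end c F & F P.
Proof.
move=> hP nPc acc; apply: contrapT => /forall2NP nF.
have [u [cu hu]] : exists u, (c < u \/ u = +oo)%E /\
    forall t : \bar R, (c < t <= u)%E -> ~ P t.
  have [c1|] := ltP c +oo%E; last first.
    by rewrite leye_eq => /eqP ->; exists +oo%E; split=> [|t /andP[]];
      [right|rewrite ltNge leey].
  have e : is_end c (right_end c) by left.
  have [//|nP] := nF (right_end c); have [//|[b cb hb]] := end_decided e hP.
  have [u /andP[cu ub]] := ereal_between cb; exists u; split; first by left.
  move=> [t| |] /andP[ct tu]; first by apply: hb => //; exact: le_lt_trans tu ub.
    by move: (le_lt_trans tu ub); rewrite ltNge leey.
  by move: ct; rewrite ltNge leNye.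
have [l [lc hl]] : exists l, (l < c \/ l = -oo)%E /\
    forall t : \bar R, (l <= t < c)%E -> ~ P t.
  have [c1|] := ltP -oo%E c; last first.
    by rewrite leeNy_eq => /eqP ->; exists -oo%E; split=> [|t /andP[_]];
      [right|rewrite ltNge leNye].
  have e : is_end c (left_end c) by right.
  have [//|nP] := nF (left_end c); have [//|[b cb hb]] := end_decided e hP.
  have [l /andP[bl lc]] := ereal_between cb; exists l; split; first by left.
  move=> [t| |] /andP[lt tc]; first by apply: hb => //; exact: lt_le_trans bl lt.
    by move: tc; rewrite ltNge leey.
  by move: (lt_le_trans bl lt); rewrite ltNge leNye.
have [t Pt /andP[lt tu]] := acc l u (conj lc cu).
have [tc|ct|tc] := ltgtP t c.
- by apply: (hl t) => //; rewrite lt.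
- by apply: (hu t) => //; rewrite ct.
- by apply: nPc; rewrite -tc.
Qed.

Section Boxes.
Context (I : finType).
Implicit Types (A : set (I -> \bar R)) (s : seq I) (f : \bar R -> I -> \bar R).

(** The coordinates of f have definable graphs; unlike the definable curves of
    the statement, f is total and takes values in the extended line. *)
Definition definable_map f : Prop :=
  forall i, dfn (fun p : \bar R * \bar R => p.2 = f p.1 i).

Lemma dfn_map (T : Type) (cT : coordinates R T) f i (q r : T -> \bar R) :
  definable_map f -> substitution q -> substitution r ->
  dfn (fun t => r t = f (q t) i).
Proof. by move=> hf hq hr; exact: (dfn_subst (subst_pair hq hr) (hf i)). Qed.

Lemma dfn_comp f (P : (I -> \bar R) -> Prop) : definable_map f -> dfn P ->
  dfn (fun t => P (f t)).
Proof.
move=> hf hP.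
apply: (dfn_ext (P := fun t => exists w, (forall i, w i = f t i) /\ P w)).
  move=> t; split=> [[w [wE]]|Pf]; last by exists (f t).
  by have -> : w = f t by apply: funext.
apply: dfn_ex_fun; apply: dfn_and.
  by apply: dfn_forall => i; apply: dfn_map hf _ _; variables.
by apply: dfn_subst hP; variables.
Qed.

Lemma definable_map_tends c (F : set_system (\bar R)) f i :
  is_end c F -> definable_map f -> exists y, tends F (f^~ i) y.
Proof.
move=> Fe hf; have FF := end_filter Fe; apply: tends_exists => x.
have h : dfn (fun w : I -> \bar R => (w i <= x)%E) by apply: dfn_le; variables.
have := end_decided Fe (dfn_comp hf h).
case=> H; [by left|right]; apply: filterS H => t /= /negP.
by rewrite -ltNge.
Qed.

(** The closure of A inside the slices in which the coordinates outside s are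
    fixed. *)
Definition slice_closure s A : set (I -> \bar R) := [set y |
  forall l u : I -> \bar R, (forall i, around (l i) (y i) (u i)) ->
  exists e, [/\ A e, forall i, i \notin s -> e i = y i
              & forall i, (l i <= e i <= u i)%E]].

Lemma slice_closureS s s' A : {subset s <= s'} ->
  slice_closure s A `<=` slice_closure s' A.
Proof.
move=> ss y hy l u lu; have [e [Ae eE elu]] := hy l u lu; exists e; split=> //.
by move=> i is'; apply: eE; apply: contra is' => /ss.
Qed.

Lemma slice_closure_box s A (l u : I -> \bar R) :
  slice_closure s A `<=` A ->
  slice_closure s [set e | A e /\ forall i, (l i <= e i <= u i)%E] `<=`
    [set e | A e /\ forall i, (l i <= e i <= u i)%E].
Proof.
move=> cA y hy; split.
  by apply: cA => l' u' /hy[e [[Ae _] eE elu]]; exists e.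
move=> i; apply/andP; split; rewrite leNgt; apply/negP => /ereal_between[m].
- move=> /andP[ym ml].
  have [|e [[_ /(_ i)/andP[le _]] _ /(_ i)]] := hy (fun=> -oo%E)
      (fun j => if j == i then m else +oo%E).
    by move=> j; split; [right|case: eqP => [->|]; [left|right]].
  by rewrite eqxx => /andP[_]; rewrite leNgt (lt_le_trans ml le).
- move=> /andP[um my].
  have [|e [[_ /(_ i)/andP[_ eu]] _ /(_ i)]] := hy
      (fun j => if j == i then m else -oo%E) (fun=> +oo%E).
    by move=> j; split; [case: eqP => [->|]; [left|right]|right].
  by rewrite eqxx leNgt (le_lt_trans eu um).
Qed.

(** Compactness of boxes of the extended line: a coordinate attains its infimum
    on a closed set. *)
Lemma slice_min s A i (y0 : I -> \bar R) :
  slice_closure s A `<=` A -> i \in s ->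
  (exists e, A e /\ forall j, j \notin s -> e j = y0 j) ->
  exists e, [/\ A e, forall j, j \notin s -> e j = y0 j
    & e i = ereal_inf [set e i | e in [set e | A e /\
                         forall j, j \notin s -> e j = y0 j]]].
Proof.
move=> cA is_ [e0 [Ae0 e0E]].
set S := [set e | A e /\ _]; set m := ereal_inf _.
(* The points of the slice whose i-th coordinate is close to the infimum; x may
   be infinite because the infimum may be. *)
pose G : set_system (I -> \bar R) := [set B |
  exists2 x, (m < x \/ x = +oo)%E & forall e, S e -> (e i <= x)%E -> B e].
have GF : ProperFilter G.
  split.
    move=> [x hx h].
    have [e Se ex] : exists2 e, S e & (e i <= x)%E.
      case: hx => [/ereal_inf_lt[_ [e Se <-] ex]|->]; first by exists e => //; exact: ltW.
      by exists e0 => //; exact: leey.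
    exact: h Se ex.
  split; first by exists +oo%E; [right|].
    move=> B C [x hx hB] [z hz hC]; exists (mine x z).
      by rewrite /mine; case: ifP.
    by move=> e Se; rewrite le_min => /andP[ex ez]; split; [exact: hB|exact: hC].
  by move=> B C BC [x hx hB]; exists x => // e Se ex; exact/BC/hB.
have [U [UU GU]] := ultraFilterLemma GF.
have /choice[y hy] j : exists y, tends U (fun e => e j) y := tends_ultra _ UU.
have GS : G S by exists +oo%E; [right|].
pose z j := if j \in s then y j else y0 j.
have Sz : S z.
  split; last by move=> j /negPf js; rewrite /z js.
  apply: cA => l u lu.
  have H : U [set e | forall j, j \in s -> (l j <= e j <= u j)%E].
    apply: filter_forall => j; case js : (j \in s); last by apply: filterS filterT.
    have h : around (l j) (y j) (u j) by have := lu j; rewrite /z js.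
    by apply: filterS (hy j _ _ h) => e /= ->.
  have [e [[Ae eE] elu]] := filter_ex (filterI (GU _ GS) H).
  exists e; split=> // j; first by move=> js; rewrite eE // /z (negPf js).
  case js : (j \in s); first exact: elu.
  by have := around_mem (lu j); rewrite /z js eE ?js.
exists z; split; [exact: Sz.1|exact: Sz.2|].
apply/le_anti/andP; split; last by apply: ereal_inf_lbound; exists z.
rewrite /z is_ leNgt; apply/negP => /ereal_between[x /andP[mx xy]].
have : (y i <= x)%E.
  apply: tends_le (hy i) _; apply: GU.
  by exists x; [left|].
by rewrite leNgt xy.
Qed.

(** Definable choice, one coordinate after the other: the least value of a
    coordinate on a definable closed set depends definably on the slice. *)
Lemma slice_selection s A f0 : dfn A -> slice_closure s A `<=` A ->
  definable_map f0 ->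
  exists f, [/\ definable_map f, forall t i, i \notin s -> f t i = f0 t i
    & forall t, (exists e, A e /\ forall i, i \notin s -> e i = f0 t i) -> A (f t)].
Proof.
move=> hA; elim: s f0 => [|i s IH] f0 cA hf0.
  exists f0; split=> // t [e [Ae eE]].
  by have <- : e = f0 t by apply: funext => j; exact: eE.
pose S t := [set e | A e /\ forall j, j \notin i :: s -> e j = f0 t j].
pose f1 t j := if j == i then ereal_inf [set e i | e in S t] else f0 t j.
have hf1 : definable_map f1.
  move=> j; rewrite /f1; case: (j == i) => //.
  (* The set S is quantified over in several contexts. *)
  have hS (T : Type) (cT : coordinates R T) (q : T -> \bar R) (w : T -> I -> \bar R) :
      substitution q -> substitution w -> dfn (fun t => S (q t) (w t)).
    move=> hq hw; apply: dfn_and; first exact: dfn_subst hA.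
    apply: dfn_forall => k; apply: dfn_imp; first exact: dfn_cst.
    by apply: dfn_map => //; eapply subst_app.
  apply: (dfn_ext (P := fun p : \bar R * \bar R =>
      (forall e, S p.1 e -> (p.2 <= e i)%E) /\
      (forall x, (forall e, S p.1 e -> (x <= e i)%E) -> (x <= p.2)%E))).
    move=> [t x] /=; split=> [[lb glb]|->].
      apply/le_anti/andP; split.
        by apply: le_ereal_inf_tmp => _ [e Se <-]; exact: lb.
      by apply: glb => e Se; apply: ereal_inf_lbound; exists e.
    split=> [e Se|x' lb]; first by apply: ereal_inf_lbound; exists e.
    by apply: le_ereal_inf_tmp => _ [e Se <-]; exact: lb.
  apply: dfn_and.
    by apply: dfn_all_fun; apply: dfn_imp; [apply: hS|apply: dfn_le]; variables.
  apply: dfn_all; apply: dfn_imp; last by apply: dfn_le; variables.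
  by apply: dfn_all_fun; apply: dfn_imp; [apply: hS|apply: dfn_le]; variables.
have ss : {subset s <= i :: s} by move=> j js; rewrite inE js orbT.
have [f [hf fE fA]] := IH f1 (subset_trans (slice_closureS ss) cA) hf1.
have f1E t j : j \notin i :: s -> f1 t j = f0 t j.
  by rewrite inE negb_or /f1 => /andP[/negPf ->].
exists f; split=> // [t j jis|t h].
  rewrite fE ?f1E //; first by apply: contra jis => /ss.
apply: fA; have [e [Ae eE ei]] := slice_min cA (mem_head i s) h.
exists e; split=> // j js.
have [->|ji] := eqVneq j i; first by rewrite /f1 eqxx.
by rewrite /f1 (negPf ji); apply: eE; rewrite inE negb_or ji.
Qed.

Definition curve_closed A : Prop := forall c (F : set_system (\bar R)) f y,
  is_end c F -> definable_map f -> F [set t | A (f t)] ->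
  (forall i, tends F (f^~ i) (y i)) -> A y.

(** By induction on the free coordinates, the slice of A through c is closed, so
    a box around c misses it. The points selected in this box on the
    neighbouring slices form a curve, whose limit would be in A, in the box and in
    the slice through c. *)
Lemma curve_closed_closed s A : dfn A -> curve_closed A ->
  slice_closure s A `<=` A.
Proof.
move=> hA ccA; elim: s => [|i s IH] c hc.
  have [|e [Ae eE _]] := hc (fun=> -oo%E) (fun=> +oo%E).
    by move=> i; exact: around_all.
  by have <- : e = c by apply: funext => i; exact: eE.
have [is_|is_] := boolP (i \in s).
  by apply: IH; apply: slice_closureS hc => j; rewrite inE => /predU1P[->|].
apply: contrapT => nAc.
have /existsNP[l /existsNP[u /not_implyP[lu nlu]]] : ~ slice_closure s A c.
  by move/IH.
pose B := [set e | A e /\ forall j, (l j <= e j <= u j)%E].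
have cB : slice_closure s B `<=` B by exact: slice_closure_box.
have hB : dfn B.
  apply: dfn_and => //; apply: dfn_forall => j.
  apply: (dfn_ext (P := fun e => (l j <= e j)%E /\ (e j <= u j)%E)).
    by move=> e; split=> /andP.
  by apply: dfn_and; apply: dfn_le; variables.
pose f0 (t : \bar R) j := if j == i then t else c j.
have hf0 : definable_map f0.
  by move=> j; apply: dfn_eq; variables.
have [f [hf fE fB]] := slice_selection hB cB hf0.
pose P t := exists e, B e /\ forall j, j \notin s -> e j = f0 t j.
have f0c : f0 (c i) = c by apply: funext => j; rewrite /f0; case: eqP => [->|].
have nPc : ~ P (c i).
  by rewrite /P f0c => -[e [[Ae elu] eE]]; apply: nlu; exists e.
have PE t : P t <-> B (f t).
  split=> [|Bft]; first exact: fB.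
  by exists (f t); split=> // j; exact: fE.
have hP : dfn P by apply: dfn_ext (dfn_comp hf hB) => t; rewrite PE.
(* Since c adheres to A, some slices arbitrarily close to c meet the box, hence
   all those near c on one side. *)
have [|F Fe FP] := end_exists hP nPc.
  move=> l' u' lu'.
  have [|e [Ae eE elu]] := hc (fun j => maxe (l j) (if j == i then l' else -oo%E))
      (fun j => mine (u j) (if j == i then u' else +oo%E)).
    move=> j; apply: around_cap => //.
    by case: eqP => [->//|_]; exact: around_all.
  exists (e i).
    exists e; split; first split=> // j.
      by have := elu j; rewrite ge_max le_min => /andP[/andP[-> _] /andP[-> _]].
    move=> j js; rewrite /f0; case: eqP => [->//|/eqP ji].
    by apply: eE; rewrite inE negb_or ji.
  by have := elu i; rewrite eqxx ge_max le_min => /andP[/andP[_ ->] /andP[_ ->]].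
have FF := end_filter Fe.
have FB : F [set t | B (f t)] by apply: filterS FP => t /PE.
have /choice[y hy] j := definable_map_tends j Fe hf.
have Ay : A y.
  by apply: ccA Fe hf _ hy; apply: filterS FB => t [].
apply: nlu; exists y; split=> // j.
  move=> js; apply: tends_unique (hy j) _.
  have -> : f^~ j = f0^~ j by apply: funext => t; exact: fE.
  rewrite /f0; case: eqP => [->|_]; first exact: tends_end Fe.
  exact: tends_cst.
apply/andP; split.
  by apply: tends_ge (hy j) _; apply: filterS FB => t /= [_ /(_ j)/andP[]].
by apply: tends_le (hy j) _; apply: filterS FB => t /= [_ /(_ j)/andP[]].
Qed.

End Boxes.
End Curves.

(** * Neighbourhoods, ends of curves, and compact spaces *)

(** A nonempty space is pointed by any of its points, and the empty one satisfies
    both sides trivially. *)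
Lemma cover_compactP (T : topologicalType) : cover_compact [set: T] <->
  forall F : set_system T, ProperFilter F -> cluster F !=set0.
Proof.
have [[x0 _]|T0] := pselect ([set: T] !=set0); last first.
  split=> [_ F FF|_ I D f _ _].
    by have [x _] := filter_ex (@filterT _ F _); case: T0; exists x.
  exists fset0; first by move=> i; rewrite inE.
  by move=> x; case: T0; exists x.
pose pT : ptopologicalType := HB.pack T (isPointed.Build T x0).
have := compact_cover pT => /(congr1 (fun C => C [set: T])) E.
rewrite -[cover_compact _]/(@cover_compact pT setT) -E.
split=> [cT F FF|cT F FF _].
  by have [x [_ Fx]] := cT F FF filterT; exists x.
by have [x Fx] := cT F FF; exists x.
Qed.

Section RealNeighbourhoods.
Context (R : realType).
Local Open Scope ereal_scope.

Lemma around_nbhs (l u : \bar R) (r : R) : around l r%:E u ->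
  nbhs r [set s | l <= s%:E <= u].
Proof.
move=> [hl hu]; apply: (@nbhs_interval _ _ _ l u).
- by case: hl => [//|->]; rewrite ltNyr.
- by case: hu => [//|->]; rewrite ltry.
- by move=> s /ltW ls /ltW su /=; rewrite ls.
Qed.

Lemma nbhs_around (r : R) (P : set R) : nbhs r P -> exists l u,
  around l r%:E u /\ forall s : R, l <= s%:E <= u -> P s.
Proof.
move=> /nbhs_ballP[e /= e0 eP].
exists (r - e / 2)%:E, (r + e / 2)%:E; split.
  by split; left; rewrite lte_fin ?ltrBlDr ltrDl divr_gt0.
move=> s; rewrite !lee_fin => /andP[ls su]; apply: eP.
rewrite /ball /= distrC ltr_distl.
have e2 : (e / 2 < e)%R by rewrite ltr_pdivrMr // ltr_pMr // ltr1n.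
by rewrite (lt_le_trans _ ls) ?(le_lt_trans su) // ?ltrD2l // ltrN2.
Qed.

Lemma around_inside (l y u : \bar R) : around l y u ->
  exists l' u', around l' y u' /\ forall x, l' <= x <= u' -> around l x u.
Proof.
move=> [hl hu].
have [l' [hl' Hl]] : exists l', (l' < y \/ l' = -oo) /\
    forall x, l' <= x -> l < x \/ l = -oo.
  case: hl => [ly|->]; last by exists -oo; split; right.
  have [m /andP[lm my]] := ereal_between ly; exists m; split; first by left.
  by move=> x mx; left; exact: lt_le_trans mx.
have [u' [hu' Hu]] : exists u', (y < u' \/ u' = +oo) /\
    forall x, x <= u' -> x < u \/ u = +oo.
  case: hu => [yu|->]; last by exists +oo; split; right.
  have [m /andP[ym mu]] := ereal_between yu; exists m; split; first by left.
  by move=> x xm; left; exact: le_lt_trans mu.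
by exists l', u'; split=> // x /andP[/Hl ? /Hu ?].
Qed.

Lemma around_disjoint (y z : \bar R) : y != z -> exists l u l' u',
  [/\ around l y u, around l' z u' &
      forall x, l <= x <= u -> l' <= x <= u' -> False].
Proof.
have H (a b : \bar R) : a < b -> exists m m', [/\ a < m, m < m' & m' < b].
  move=> /ereal_between[m /andP[am /ereal_between[m' /andP[mm' m'b]]]].
  by exists m, m'.
rewrite neq_lt => /orP[] /H[m [m' [h1 h2 h3]]].
- exists -oo, m, m', +oo; split; [by split; [right|left]|by split; [left|right]|].
  by move=> x /andP[_ xm] /andP[m'x _]; move: h2; rewrite ltNge (le_trans m'x xm).
- exists m', +oo, -oo, m; split; [by split; [left|right]|by split; [right|left]|].
  by move=> x /andP[m'x _] /andP[_ xm]; move: h2; rewrite ltNge (le_trans m'x xm).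
Qed.

End RealNeighbourhoods.

Section CurveEnds.
Context (R : realType) (n : nat) (X : top_space R n) (a b : \bar R).
Context (gamma : oitv a b -> X).
Local Open Scope ereal_scope.

(** The parameters of the points of the curve that lie in A, as a subset of the
    extended line, so that convergence at an end of the curve can be read off the
    filter of that end. *)
Definition along (A : set X) : set (\bar R) :=
  [set x | exists s : oitv a b, x = (\val s)%:E /\ A (gamma s)].

Lemma oitvE (t : R) : a < t%:E -> t%:E < b -> exists s : oitv a b, \val s = t.
Proof.
move=> at_ tb; have h : oitv a b t by rewrite /oitv /= at_.
by exists (SigSub (mem_set h)).
Qed.

Lemma oitvP (s : oitv a b) : a < (\val s)%:E /\ (\val s)%:E < b.
Proof. by apply/andP; exact: set_valP s. Qed.

Lemma cvg_left_endP (x : X) : a < b ->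
  cvg_left_end gamma x <-> forall A, nbhs x A -> right_end a (along A).
Proof.
move=> ab; split=> cx A /cx.
  move=> [tA h]; have [atA tAb] := oitvP tA; exists (\val tA)%:E => // t at_ tt.
  have [s st] := oitvE at_ (lt_trans tt tAb); exists s; rewrite st; split=> //.
  by apply: h; rewrite st -lte_fin.
move=> [b' ab' h].
have [|t /andP[at_]] := real_between (x := a) (y := mine b b').
  by rewrite lt_min ab.
rewrite lt_min => /andP[tb tb'].
have [tA tAE] := oitvE at_ tb; exists tA => s; rewrite tAE -lte_fin => st.
have [as_ _] := oitvP s.
have [s' [[/val_inj ->]]] // := h (\val s) as_ (lt_trans st tb').
Qed.

Lemma cvg_right_endP (x : X) : a < b ->
  cvg_right_end gamma x <-> forall A, nbhs x A -> left_end b (along A).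
Proof.
move=> ab; split=> cx A /cx.
  move=> [tA h]; have [atA tAb] := oitvP tA; exists (\val tA)%:E => // t tt tb.
  have [s st] := oitvE (lt_trans atA tt) tb; exists s; rewrite st; split=> //.
  by apply: h; rewrite st -lte_fin.
move=> [a' ab' h].
have [|t /andP[+ tb]] := real_between (x := maxe a a') (y := b).
  by rewrite gt_max ab.
rewrite gt_max => /andP[at_ ta'].
have [tA tAE] := oitvE at_ tb; exists tA => s; rewrite tAE -lte_fin => st.
have [_ sb] := oitvP s.
have [s' [[/val_inj ->]]] // := h (\val s) (lt_trans ta' st) sb.
Qed.

End CurveEnds.

Section CompactCurves.
Context (L : language) (R : realType) (M : expansion L R) (hM : o_minimal M).
Context (n : nat) (X : top_space R n).

Lemma coords_inj : injective (@coords R n X).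
Proof. by move=> x y; exact: val_inj. Qed.

(** The parameters t for which some w is both the point of the curve at t and a
    member of the given fibre of S. *)
Lemma dfn_along (a b : \bar R) (gamma : oitv a b -> X) (m : nat)
    (S : set 'rV[R]_(n + m)) (c : 'rV[R]_m) (A : set X) :
  definable_curve M gamma -> definable M S ->
  [set coords x | x in A] = [set x | S (row_mx x c)] -> dfn M (along gamma A).
Proof.
move=> /dfn_definable hg /dfn_definable hS AE.
pose q (p : \bar R * ('I_n -> \bar R)) (i : 'I_(1 + n)) : \bar R :=
  match fintype.split i with inl _ => p.1 | inr j => p.2 j end.
pose r (p : \bar R * ('I_n -> \bar R)) (i : 'I_(n + m)) : \bar R :=
  match fintype.split i with inl j => p.2 j | inr k => (c 0 k)%:E end.
have hq : substitution q.
  by apply: subst_lam => i; rewrite /q; case: (fintype.split i) => j; variables.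
have hr : substitution r.
  by apply: subst_lam => i; rewrite /r; case: (fintype.split i) => j; variables.
pose G := range (fun t : oitv a b => row_mx (vec1 (\val t)) (coords (gamma t))).
apply: (dfn_ext (P := fun t => exists w,
    (exists x, G x /\ forall i, q (t, w) i = (x 0 i)%:E) /\
    (exists x, S x /\ forall i, r (t, w) i = (x 0 i)%:E))); last first.
  apply: dfn_ex_fun; apply: dfn_and.
    by apply: dfn_ext (dfn_subst hq hg) => -[t w].
  by apply: dfn_ext (dfn_subst hr hS) => -[t w].
move=> t; split.
- move=> [w [[_ [[s _ <-] qE]] [x [Sx rE]]]]; exists s.
  have wE i : w i = (coords (gamma s) 0 i)%:E.
    by have := qE (rshift 1 i); rewrite /q (unsplitK (inr i)) row_mxEr.
  split; first by have := qE (lshift n ord0); rewrite /q (unsplitK (inl ord0)) row_mxEl mxE.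
  have xE : x = row_mx (coords (gamma s)) c.
    apply/rowP => i; apply: EFin_inj; rewrite -rE /r mxE.
    by case: (fintype.split i).
  have : [set coords x | x in A] (coords (gamma s)) by rewrite AE /= -xE.
  by move=> [p Ap /coords_inj <-].
- move=> [s [-> As]]; exists (fun i => (coords (gamma s) 0 i)%:E); split.
    exists (row_mx (vec1 (\val s)) (coords (gamma s))); split; first by exists s.
    by move=> i; rewrite /q mxE; case: (fintype.split i) => // j; rewrite mxE.
  exists (row_mx (coords (gamma s)) c); split; last first.
    by move=> i; rewrite /r mxE; case: (fintype.split i).
  have : [set x | S (row_mx x c)] (coords (gamma s)) by rewrite -AE; exists (gamma s).
  by [].
Qed.

(** A cluster point of the curve is a limit: a basic neighbourhood of it meets the
    curve arbitrarily near the end and, the trace being definable, contains the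
    curve near the end. *)
Lemma compact_end (a b c : \bar R) (gamma : oitv a b -> X) (F : set_system (\bar R)) :
  definable_top_space M X -> cover_compact [set: X] -> definable_curve M gamma ->
  is_end c F -> F (along gamma setT) ->
  exists x : X, forall A : set X, nbhs x A -> F (along gamma A).
Proof.
move=> [B [[Bo Bx] [m [S [D [hS _ BE]]]]]] /cover_compactP cX hg Fe FT.
have FF := end_filter Fe.
pose G : set_system X := [set A | F (along gamma A)].
have GF : ProperFilter G.
  split; first by move=> F0; have [x [s []]] := filter_ex (F0 : F (along gamma set0)).
  split=> //.
    move=> P Q; rewrite /G /= => FP FQ; apply: filterS2 FP FQ => x [s [xs Ps]] [s' [xs' Qs]].
    have ss' : s = s' by apply/val_inj/EFin_inj; rewrite -xs -xs'.
    by exists s; split=> //; split=> //; rewrite ss'.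
  by move=> P Q PQ; rewrite /G /= => FP; apply: filterS FP => x [s [-> /PQ ?]]; exists s.
have [x xG] := cX G GF; exists x => A xA.
have [V [BV Vx] VA] := Bx x A xA.
have : [set [set coords x | x in U] | U in B] [set coords x | x in V] by exists V.
rewrite BE => -[d _ dE].
have [FV|FV] := end_decided hM Fe (dfn_along hg hS (esym dE)).
  by apply: filterS FV => t [s [-> /VA ?]]; exists s.
have GnV : G (~` V).
  rewrite /G /=; apply: filterS2 FT FV => t [s [-> _]] nV.
  by exists s; split=> // Vs; apply: nV; exists s.
have nV : nbhs x V by apply: open_nbhs_nbhs; split=> //; exact: Bo.
by have [y []] := xG _ _ GnV nV.
Qed.

Lemma compact_curve_compact : definable_top_space M X ->
  cover_compact [set: X] -> curve_compact M X.
Proof.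
move=> hX cX a b gamma ab hg; split.
- have e : is_end a (right_end a) by left; split=> //; exact: lt_le_trans ab (leey _).
  have [|x hx] := compact_end hX cX hg e.
    by exists b => // t at_ /(oitvE at_)[s <-]; exists s.
  by exists x; apply/cvg_left_endP.
- have e : is_end b (left_end b) by right; split=> //; exact: le_lt_trans (leNye _) ab.
  have [|x hx] := compact_end hX cX hg e.
    by exists a => // t at_ /(oitvE at_)[s <-]; exists s.
  by exists x; apply/cvg_right_endP.
Qed.

End CompactCurves.

(** * Charts as functions on the space *)

(** A chart as a function on the whole space, with the junk value 0 outside U, to
    avoid subtypes. The last two clauses say that the topology of U is the one
    pulled back by h. *)
Lemma chart_function (L : language) (R : realType) (M : expansion L R)
    (n : nat) (X : top_space R n) (U : set X) : definable_chart M U ->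
  exists (m : nat) (h : X -> 'rV[R]_m),
    [/\ definable M [set x | exists2 p, U p & x = row_mx (coords p) (h p)],
        forall p q, U p -> U q -> h p = h q -> p = q,
        forall p (O : set X), U p -> nbhs p O ->
          exists2 W, nbhs (h p) W & forall q, U q -> W (h q) -> O q
      & forall p W, U p -> nbhs (h p) W ->
          nbhs p [set q : X | U q -> W (h q)]].
Proof.
move=> [m [V [h [g [hV hG [hg gh] ch cg]]]]].
pose h' (p : X) : 'rV[R]_m :=
  if pselect (U p) is left Up then \val (h (SigSub (mem_set Up))) else 0.
have h'E (u : U) : h' (\val u) = \val (h u).
  rewrite /h'; case: pselect => [Up|nU]; last by case: nU; exact: set_valP.
  by congr (\val (h _)); exact: val_inj.
have UE p : U p -> exists u : U, \val u = p.
  by move=> Up; exists (SigSub (mem_set Up)).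
exists m, h'; split.
- move: hG; congr definable; apply/seteqP; split=> [_ [u _ <-]|_ [p Up ->]].
    by exists (\val u); [exact: set_valP|rewrite h'E].
  by have [u <-] := UE p Up; exists u => //; rewrite h'E.
- move=> p q /UE[u <-] /UE[v <-]; rewrite !h'E => /val_inj E.
  by rewrite -(hg u) E hg.
- move=> p O /UE[u <-] uO.
  have : nbhs (h u) [set v | O (\val (g v))].
    have := @cg (h u) [set v | O (\val v)]; rewrite hg; apply.
    exact: (@initial_continuous _ _ (\val : U -> X) u).
  rewrite nbhsE => -[C [[W oW <-] Wu] WC]; exists W.
    by rewrite h'E; apply: open_nbhs_nbhs.
  move=> q /UE[v <-]; rewrite h'E => Wv.
  by have := WC (h v) Wv; rewrite /= hg.
- move=> p W /UE[u <-]; rewrite h'E => uW.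
  have : nbhs u [set v | W (\val (h v))].
    apply: (@ch u [set v | W (\val v)]).
    exact: (@initial_continuous _ _ (\val : V -> 'rV[R]_m) (h u)).
  rewrite nbhsE => -[C [[N oN <-] Nu] NC].
  apply: (@filterS _ _ _ N); last exact: open_nbhs_nbhs.
  by move=> q Nq /UE[v vq]; move: Nq; rewrite -vq h'E => Nv; exact: (NC v Nv).
Qed.

Section Atlas.
Context (L : language) (R : realType) (M : expansion L R).
Context (n : nat) (X : top_space R n).
Context (k : nat) (U : 'I_k -> set X).
Context (I : finType) (blk : I -> 'I_k) (H : X -> I -> R).

Definition at_point (w : 'I_n -> \bar R) (p : X) : Prop :=
  forall a, w a = (coords p 0 a)%:E.

(** The coordinates of all charts are put together into one family H, the
    function H j belonging to the chart number blk j; only the values of H j on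
    the domain of that chart matter. The last two fields say that the topology of
    this domain is that of its coordinates. *)
Record atlas : Prop := Atlas {
  atlas_cover : forall p, exists i, U i p;
  atlas_open : forall i, open (U i);
  atlas_domain : forall i,
    dfn M (fun w : 'I_n -> \bar R => exists2 p, U i p & at_point w p);
  atlas_graph : forall i,
    dfn M (fun wy : ('I_n -> \bar R) * (I -> \bar R) => exists2 p, U i p &
      at_point wy.1 p /\ forall j, blk j = i -> wy.2 j = (H p j)%:E);
  atlas_inj : forall i p q, U i p -> U i q ->
    (forall j, blk j = i -> H p j = H q j) -> p = q;
  atlas_finer : forall i p (O : set X), U i p -> nbhs p O ->
    exists l u : I -> \bar R, (forall j, around (l j) (H p j)%:E (u j)) /\
      forall q, U i q ->
        (forall j, blk j = i -> (l j <= (H q j)%:E <= u j)%E) -> O q;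
  atlas_coarser : forall p j l u, U (blk j) p -> around l (H p j)%:E u ->
    nbhs p [set q : X | U (blk j) q -> (l <= (H q j)%:E <= u)%E] }.

End Atlas.

Lemma manifold_atlas (L : language) (R : realType) (M : expansion L R)
    (n : nat) (X : top_space R n) : definable_manifold_space M X ->
  exists (k : nat) (U : 'I_k -> set X) (I : finType) (blk : I -> 'I_k)
    (H : X -> I -> R), atlas M U blk H.
Proof.
move=> [_ [k [U [Ucov hU]]]].
pose spec i (c : {m : nat & X -> 'rV[R]_m}) := let h := projT2 c in
  [/\ definable M [set x | exists2 p, U i p & x = row_mx (coords p) (h p)],
        forall p q, U i p -> U i q -> h p = h q -> p = q,
        forall p (O : set X), U i p -> nbhs p O ->
          exists2 W, nbhs (h p) W & forall q, U i q -> W (h q) -> O q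
      & forall p W, U i p -> nbhs (h p) W ->
          nbhs p [set q : X | U i q -> W (h q)]].
have /choice[c hc] : forall i, exists c, spec i c.
  move=> i; have [_ _ hi] := hU i; have [m [h hh]] := chart_function hi.
  by exists (existT _ m h).
pose m i := projT1 (c i); pose h i : X -> 'rV[R]_(m i) := projT2 (c i).
have hh i : [/\ definable M [set x | exists2 p, U i p &
        x = row_mx (coords p) (h i p)],
        forall p q, U i p -> U i q -> h i p = h i q -> p = q,
        forall p (O : set X), U i p -> nbhs p O ->
          exists2 W, nbhs (h i p) W & forall q, U i q -> W (h i q) -> O q
      & forall p W, U i p -> nbhs (h i p) W ->
          nbhs p [set q : X | U i q -> W (h i q)]] := hc i.
exists k, U, {i : 'I_k & 'I_(m i)}, (fun j => tag j),
  (fun p j => h (tag j) p 0 (tagged j)); split.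
- move=> p; have : (\bigcup_i U i) p by rewrite Ucov.
  by move=> [i _ Uip]; exists i.
- by move=> i; have [] := hU i.
- move=> i; have [_ /dfn_definable hd _] := hU i; apply: dfn_ext hd => w.
  by split=> [[_ [[p Up <-] wp]]|[p Up wp]]; [exists p|exists (coords p); split=> //; exists p].
- move=> i; have [/dfn_definable hd _ _ _] := hh i.
  pose q (wy : ('I_n -> \bar R) * ({i : 'I_k & 'I_(m i)} -> \bar R))
      (b : 'I_(n + m i)) : \bar R :=
    match fintype.split b with inl a => wy.1 a | inr c => wy.2 (Tagged _ c) end.
  have hq : substitution q.
    by apply: subst_lam => b; rewrite /q; case: (fintype.split b) => a; variables.
  apply: dfn_ext (dfn_subst hq hd) => -[w y] /=; split.
    move=> [_ [[p Up ->] wyE]]; exists p => //; split.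
      move=> a; have := wyE (lshift _ a).
      by rewrite /q (unsplitK (inl a)) row_mxEl.
    move=> [i' j] /= E; move: E j => -> j; have := wyE (rshift _ j).
    by rewrite /q (unsplitK (inr j)) row_mxEr.
  move=> [p Up [wE yE]]; exists (row_mx (coords p) (h i p)); split; first by exists p.
  move=> b; rewrite /q mxE; case: (fintype.split b) => a; first exact: wE.
  exact: (yE (Tagged _ a)).
- move=> i p q Up Uq E; have [_ inj _ _] := hh i; apply: inj => //.
  by apply/rowP => a; exact: (E (Tagged _ a)).
- move=> i p O Up pO; have [_ _ finer _] := hh i.
  have [W [P hP PW] WO] := finer p O Up pO.
  have /choice[l /choice[u lu]] : forall j : {i : 'I_k & 'I_(m i)}, exists l u,
      around l (h (tag j) p 0 (tagged j))%:E u /\ (forall e : i = tag j, forall s,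
        (l <= s%:E <= u)%E -> P 0 (cast_ord (esym (congr1 m e)) (tagged j)) s).
    move=> j; have [e|ne] := pselect (i = tag j); last first.
      by exists -oo%E, +oo%E; split=> [|e]; [exact: around_all|case: ne].
    case: j e => i' j /= e; case: _ / e j => j.
    have [l [u [lu luP]]] := nbhs_around (hP 0 j); exists l, u; split=> // e s ls.
    by rewrite (_ : cast_ord _ j = j); [exact: luP|exact: val_inj].
  exists l, u; split=> [j|q Uq lq]; first by have [] := lu j.
  apply: WO => //; apply: PW => a b; rewrite ord1.
  have [_ /(_ erefl (h i q 0 b))] := lu (Tagged _ b).
  rewrite /= (_ : cast_ord _ b = b); last exact: val_inj.
  by apply; exact: (lq (Tagged _ b)).
- move=> p j l u Up /around_nbhs lu; have [_ _ _ coarser] := hh (tag j).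
  apply: (coarser p [set w | l <= (w 0 (tagged j))%:E <= u]%E Up).
  exact: (@coord_continuous _ _ _ 0 (tagged j) _ _ lu).
Qed.

(** * Curve-compact spaces are compact *)

Section CurveCompactAtlas.
Context (L : language) (R : realType) (M : expansion L R) (hM : o_minimal M).
Context (n : nat) (X : top_space R n).
Context (k : nat) (U : 'I_k -> set X) (I : finType) (blk : I -> 'I_k).
Context (H : X -> I -> R) (hA : atlas M U blk H).

(** The entries of y that belong to other charts are unconstrained, and may be
    infinite. *)
Definition lies_over (i : 'I_k) (y : I -> \bar R) (p : X) : Prop :=
  U i p /\ forall j, blk j = i -> y j = (H p j)%:E.

Lemma dfn_lies_over i : dfn M (fun y => exists p, lies_over i y p).
Proof.
apply: (dfn_ext (P := fun y => exists w, exists2 p, U i p &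
    at_point w p /\ forall j, blk j = i -> y j = (H p j)%:E)).
  move=> y; split=> [[w [p Up [_ yE]]]|[p [Up yE]]]; first by exists p.
  by exists (fun a => (coords p 0 a)%:E), p.
apply: dfn_ex_fun.
apply: (dfn_subst (q := fun yw : (I -> \bar R) * ('I_n -> \bar R) => (yw.2, yw.1)))
  (atlas_graph hA i).
by variables.
Qed.

(** J tells which charts contain the points under consideration: with J fixed,
    all the relevant chart functions are defined on the same set. *)
Section ActiveCharts.
Context (J : 'I_k -> Prop) (J0 : exists i, J i).

Definition cell : set (I -> \bar R) := [set y | exists p,
  (forall i, U i p <-> J i) /\ forall j, J (blk j) -> y j = (H p j)%:E].

Definition cell_closure : set (I -> \bar R) := slice_closure (enum I) cell.

Lemma dfn_cell : dfn M cell.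
Proof.
apply: (dfn_ext (P := fun y => exists w, forall i,
    (J i -> exists2 p, U i p & at_point w p /\
       forall j, blk j = i -> y j = (H p j)%:E) /\
    (~ J i -> ~ exists2 p, U i p & at_point w p))).
  move=> y; split.
    move=> [w h]; have [i0 Ji0] := J0; have [/(_ Ji0)[p Up [wp _]] _] := h i0.
    have wE q : at_point w q -> q = p.
      move=> wq; apply/coords_inj/rowP => a.
      by apply: EFin_inj; rewrite -wq -wp.
    exists p; split=> [i|j Jj]; last first.
      by have [/(_ Jj)[q _ [/wE <- qE]] _] := h (blk j); exact: qE.
    have [hJ hnJ] := h i; split=> [Uip|/hJ[q Uq [/wE <-]]//].
    by apply: contrapT => /hnJ; apply; exists p.
  move=> [p [UJ yE]]; exists (fun a => (coords p 0 a)%:E) => i; split.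
    by move=> Ji; exists p; [exact/UJ|split=> // j ji; apply: yE; rewrite ji].
  move=> nJ [q Uq qp]; apply: nJ; apply/UJ.
  suff -> : p = q by [].
  by apply/coords_inj/rowP => a; apply: EFin_inj; exact: qp.
apply: dfn_ex_fun; apply: dfn_forall => i; apply: dfn_and; apply: dfn_imp.
- exact: dfn_cst.
- apply: (dfn_subst (q := fun yw : (I -> \bar R) * ('I_n -> \bar R) => (yw.2, yw.1)))
    (atlas_graph hA i).
  by variables.
- exact: dfn_cst.
- apply: dfn_not; apply: dfn_subst (atlas_domain hA i).
  by variables.
Qed.

Lemma dfn_cell_closure : dfn M cell_closure.
Proof.
apply: (dfn_ext (P := fun y => forall l u : I -> \bar R,
    (forall i, ((l i < y i)%E \/ l i = -oo%E) /\ ((y i < u i)%E \/ u i = +oo%E)) ->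
    exists e, cell e /\ forall i, (l i <= e i)%E /\ (e i <= u i)%E)).
  move=> y; split=> h l u /h[e].
    move=> [ce elu]; exists e; split=> // i; first by rewrite mem_enum.
    by have [-> ->] := elu i.
  by move=> [ce _ elu]; exists e; split=> // i; apply/andP.
do 2 apply: dfn_all_fun; apply: dfn_imp.
  by apply: dfn_forall => i; apply: dfn_and; apply: dfn_or;
    first [apply: dfn_lt|apply: dfn_eq]; variables.
apply: dfn_ex_fun; apply: dfn_and; first by apply: dfn_subst dfn_cell; variables.
by apply: dfn_forall => i; apply: dfn_and; apply: dfn_le; variables.
Qed.

(** A point over which an adherent point of the cell lies is a limit of points
    of the cell: so all its charts are active, and all its coordinates are those
    of the adherent point. *)
Lemma lies_over_transfer y i p i' : cell_closure y -> J i -> lies_over i y p ->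
  U i' p -> J i' /\ lies_over i' y p.
Proof.
move=> cy Ji [Uip yE] Ui'p.
(* Some point of the cell is close both to p in the space and to y in
   coordinates. *)
have near (O : set X) (l u : I -> \bar R) : nbhs p O ->
    (forall j, around (l j) (y j) (u j)) ->
    exists q, [/\ O q, forall i, U i q <-> J i &
      forall j, J (blk j) -> (l j <= (H q j)%:E <= u j)%E].
  move=> pO lu; have [l' [u' [lu' O']]] := atlas_finer hA Uip pO.
  have [|e [[q [UJ eE]] _ elu]] := cy
      (fun j => maxe (l j) (if blk j == i then l' j else -oo%E))
      (fun j => mine (u j) (if blk j == i then u' j else +oo%E)).
    move=> j; apply: around_cap => //; case: eqP => [bj|_]; last exact: around_all.
    by rewrite yE.
  exists q; split=> //.
    apply: O' => [|j bj]; first exact/UJ.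
    have := elu j; rewrite bj eqxx eE ?bj // ge_max le_min.
    by move=> /andP[/andP[_ ->] /andP[_ ->]].
  move=> j Jj; have := elu j; rewrite eE // ge_max le_min.
  by move=> /andP[/andP[-> _] /andP[-> _]].
have Ui'O : nbhs p (U i') by apply: open_nbhs_nbhs; split=> //; exact: atlas_open hA _.
have Ji' : J i'.
  have [|q [Uq UJ _]] := near (U i') (fun=> -oo%E) (fun=> +oo%E) Ui'O.
    by move=> j; exact: around_all.
  exact/UJ.
split=> //; split=> // j bj; apply/eqP; apply: contrapT => /negP.
move=> /around_disjoint[l [u [l' [u' [lu lu' dis]]]]].
rewrite -bj in Ui'O Ui'p.
have pO := @filterI _ _ (nbhs_filter p) _ _ Ui'O (atlas_coarser hA Ui'p lu').
have [|q [[Uq /(_ Uq) Hq] _ qlu]] := near _ (fun a => if a == j then l else -oo%E)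
    (fun a => if a == j then u else +oo%E) pO.
  by move=> a; case: eqP => [->//|_]; exact: around_all.
by apply: dis Hq; have := qlu j; rewrite eqxx bj; exact.
Qed.

Definition adherent_points : set (I -> \bar R) :=
  [set y | cell_closure y /\ exists i, J i /\ exists p, lies_over i y p].

Lemma dfn_adherent_points : dfn M adherent_points.
Proof.
apply: dfn_and; first exact: dfn_cell_closure.
apply: dfn_exists => i; apply: dfn_and; first exact: dfn_cst.
exact: dfn_lies_over.
Qed.

Lemma cell_closure_tends (F : set_system (\bar R)) (f : \bar R -> I -> \bar R)
    (y : I -> \bar R) : ProperFilter F -> F [set t | cell_closure (f t)] ->
  (forall j, tends F (f^~ j) (y j)) -> cell_closure y.
Proof.
move=> FF Fc fy l u lu.
have /choice[l' /choice[u' lu']] j := around_inside (lu j).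
have Flu : F [set t | forall j, (l' j <= f t j <= u' j)%E].
  by apply: filter_forall => j; apply: fy; have [] := lu' j.
have [t [ct tlu]] := filter_ex (filterI Fc Flu).
have [|e [ce _ elu]] := ct l u; first by move=> j; have [_] := lu' j; apply.
by exists e; split=> // j; rewrite mem_enum.
Qed.

(** The coordinates of a chart being injective, the lift is determined by f: its
    graph is obtained from those of f and of the chart. *)
Lemma lift_curve (a b : \bar R) i (f : \bar R -> I -> \bar R) :
  definable_map M f ->
  (forall t : R, (a < t%:E)%E -> (t%:E < b)%E -> exists p, lies_over i (f t%:E) p) ->
  exists2 gamma : oitv a b -> X, definable_curve M gamma &
    forall s, lies_over i (f (\val s)%:E) (gamma s).
Proof.
move=> hf fl.
have /choice[gamma hg] : forall s : oitv a b, exists p,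
    lies_over i (f (\val s)%:E) p.
  by move=> s; have [? ?] := oitvP s; exact: fl.
exists gamma => //.
pose P (x : 'rV[R]_(1 + n)) := ((a < (x 0 (lshift n 0))%:E)%E /\
  ((x 0 (lshift n 0))%:E < b)%E) /\ exists v : I -> \bar R,
  (forall j, v j = f (x 0 (lshift n 0))%:E j) /\
  exists2 p, U i p & at_point (fun c => (x 0 (rshift 1 c))%:E) p /\
    forall j, blk j = i -> v j = (H p j)%:E.
have hP : dfn M P.
  apply: dfn_and; first by apply: dfn_and; apply: dfn_lt; variables.
  apply: dfn_ex_fun; apply: dfn_and.
    by apply: dfn_forall => j; apply: dfn_map => //; variables.
  apply: (dfn_subst (q := fun xv : 'rV[R]_(1 + n) * (I -> \bar R) =>
    ((fun c => (xv.1 0 (rshift 1 c))%:E), xv.2))) (atlas_graph hA i).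
  by apply: subst_pair; [apply: subst_lam => c; variables|variables].
have := definable_dfn hP; congr definable; apply/seteqP; split=> x.
- move=> [[ax xb] [v [vE [p Up [xp vp]]]]].
  have [s sE] := oitvE ax xb; exists s => //.
  have [Ug fg] := hg s.
  have gp : gamma s = p.
    apply: (atlas_inj hA Ug Up) => j bj; apply: EFin_inj.
    by rewrite -fg // -vp // vE sE.
  apply/rowP => c; rewrite -[c](splitK c); case: (fintype.split c) => d /=.
    by rewrite row_mxEl mxE sE ord1.
  by rewrite row_mxEr gp; apply: EFin_inj; rewrite -xp.
- move=> [s _ <-]; have [as_ sb] := oitvP s; have [Ug fg] := hg s.
  split; first by rewrite row_mxEl mxE.
  exists (f (\val s)%:E); split; first by rewrite row_mxEl mxE.
  by exists (gamma s) => //; split=> // c; rewrite row_mxEr.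
Qed.

(** A curve of coordinate vectors over one chart is lifted to the space, and
    curve-compactness gives a limit there, possibly outside that chart. *)
Lemma curve_limit c (F : set_system (\bar R)) i (f : \bar R -> I -> \bar R) :
  curve_compact M X -> is_end c F -> definable_map M f ->
  F [set t | exists p, lies_over i (f t) p] ->
  exists z : X, forall A : set X, nbhs z A ->
    F [set t | exists2 p, lies_over i (f t) p & A p].
Proof.
move=> cX [[c1 ->]|[c1 ->]] hf [b cb fl].
- have [gamma hg fg] := lift_curve hf fl.
  have [[z /(cvg_left_endP _ _ cb) hz] _] := cX _ _ gamma cb hg.
  exists z => A /hz[b' cb' h]; exists b' => // t ct tb'.
  by have [s [-> As]] := h t ct tb'; exists (gamma s).
- have [gamma hg fg] := lift_curve hf (fun t bt tc => fl t bt tc).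
  have [_ [z /(cvg_right_endP _ _ cb) hz]] := cX _ _ gamma cb hg.
  exists z => A /hz[b' cb' h]; exists b' => // t ct tb'.
  by have [s [-> As]] := h t ct tb'; exists (gamma s).
Qed.

(** The limit z of the lifted curve lies in some chart i'. The curve enters that
    chart, which is therefore active, and there its coordinates are those of f;
    so the limit of f has the coordinates of z in the chart i'. *)
Lemma adherent_points_curve_closed : curve_compact M X ->
  curve_closed M adherent_points.
Proof.
move=> cX c F f y Fe hf FA fy; have FF := end_filter Fe.
have Fc : F [set t | cell_closure (f t)] by apply: filterS FA => t [].
have cy : cell_closure y := cell_closure_tends FF Fc fy.
split=> //.
have [i [Ji Fi]] : exists i, J i /\ F [set t | exists p, lies_over i (f t) p].
  apply: contrapT => /forallNP nF.
  have : F [set t | forall i, ~ (J i /\ exists p, lies_over i (f t) p)].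
    apply: filter_forall => i.
    have [Ji|nJi] := pselect (J i); last by apply: filterS filterT => t _ [].
    have [Fi|Fi] := end_decided hM Fe (dfn_comp hf (dfn_lies_over i)).
      by case: (nF i).
    by apply: filterS Fi => t nl [_].
  move=> /(filterI FA)/filter_ex[t [[_ [i h]] /(_ i)]]; exact.
have [z hz] := curve_limit cX Fe hf Fi.
have [i' Uz] := atlas_cover hA z.
have Uo : nbhs z (U i') by apply: open_nbhs_nbhs; split=> //; exact: atlas_open hA _.
have near A : nbhs z A -> F [set t | exists p, [/\ J i', lies_over i' (f t) p & A p]].
  move=> zA; apply: filterS2 Fc (hz _ (filterI Uo zA)) => t ct [p lp [Up Ap]].
  by have [? ?] := lies_over_transfer ct Ji lp Up; exists p.
have [t [p [Ji' _ _]]] := filter_ex (near _ Uo).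
exists i'; split=> //; exists z; split=> // j bj.
apply: tends_unique (fy j) _ => l u lu.
have Uz' : U (blk j) z by rewrite bj.
apply: filterS (near _ (atlas_coarser hA Uz' lu)) => s [q [_ [Uq sE] lq]] /=.
by rewrite sE //; apply: lq; rewrite bj.
Qed.

Lemma cell_closure_lies_over : curve_compact M X -> forall y, cell_closure y ->
  exists i, J i /\ exists p, lies_over i y p.
Proof.
move=> cX y cy.
have [] // : adherent_points y.
apply: (curve_closed_closed (s := enum I) hM dfn_adherent_points
  (adherent_points_curve_closed cX)).
move=> l u /cy[e [ce eE elu]]; exists e; split=> //; split.
  move=> l' u' lu'; exists e; split=> // j; exact: around_mem.
have [p [UJ pE]] := ce; have [i Uip] := atlas_cover hA p.
have Ji : J i by apply/UJ.
by exists i; split=> //; exists p; split=> // j bj; apply: pE; rewrite bj.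
Qed.

End ActiveCharts.

(** An ultrafilter on the space selects its active charts; in these, the chart
    functions have limits along it. The vector of limits adheres to the cell, and
    a point over which it lies is a limit of the ultrafilter. *)
Lemma curve_compact_compact : curve_compact M X -> cover_compact [set: X].
Proof.
move=> cX; apply/cover_compactP => F0 FF0.
have [F [FU F0F]] := ultraFilterLemma FF0.
have FF : ProperFilter F := ultra_proper.
suff [z zF] : exists z : X, forall A, nbhs z A -> F A.
  exists z => A B F0A zB.
  exact: filter_ex (filterI (F0F _ F0A) (zF _ zB)).
pose J i := F (U i).
have J0 : exists i, J i.
  apply: contrapT => /forallNP nJ.
  have : F [set p | forall i, ~ U i p].
    apply: filter_forall => i.
    by have [/nJ|] := in_ultra_setVsetC (U i) FU.
  move=> Fn; have [p np] := filter_ex Fn; have [i Up] := atlas_cover hA p.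
  exact: np Up.
have FJ : F [set p | forall i, U i p <-> J i].
  apply: filter_forall => i; have [Fi|Fi] := in_ultra_setVsetC (U i) FU.
    by apply: filterS (Fi) => p Up; split.
  apply: filterS (Fi) => p nU; split=> // Ji.
  by have [q []] := filter_ex (filterI Ji Fi).
have /choice[y hy] j : exists y, tends F (fun p => (H p j)%:E) y := tends_ultra _ FU.
have cy : cell_closure J y.
  move=> l u lu.
  have Flu : F [set p | forall j, (l j <= (H p j)%:E <= u j)%E].
    by apply: filter_forall => j; exact: hy.
  have [p [pJ plu]] := filter_ex (filterI FJ Flu).
  exists (fun j => (H p j)%:E); split=> // [|j]; first by exists p.
  by rewrite mem_enum.
have [i [Ji [z [Uz yz]]]] := cell_closure_lies_over J0 cX cy.
exists z => A zA; have [l [u [lu luA]]] := atlas_finer hA Uz zA.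
have Flu : F [set p | forall j, blk j = i -> (l j <= (H p j)%:E <= u j)%E].
  apply: filter_forall => j; have [bj|nbj] := pselect (blk j = i).
    have := lu j; rewrite -yz // => /hy Fj.
    by apply: filterS Fj => p /= Hp _.
  by apply: filterS filterT => p _ /nbj.
by apply: filterS2 Ji Flu => p; exact: luA.
Qed.

End CurveCompactAtlas.

Theorem mainTheorem5 (R : realType) (L : language) (M : expansion L R)
    (hM : o_minimal M) (n : nat) (X : top_space R n)
    (hX : definable_manifold_space M X) :
  curve_compact M X <-> cover_compact [set: X].
Proof.
split; last by case: hX => hT _ cX; exact (compact_curve_compact hM hT cX).
have [k [U [I [blk [H hA]]]]] := manifold_atlas hX.
exact (curve_compact_compact hM hA).
Qed.
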